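(* Let $K$ be a commutative ring, $\mathbf{H}$ a Hopf $K$-algebra, $A$ a right $\mathbf{H}$-comodule $K$-algebra and $C$ a left $\mathbf{H}$-module $K$-coalgebra. Suppose that $C_K$ is a locally projective module, that $A_K$ is a flat module, and that $\mathrm{Rat}^r_C(-)$ is an exact functor. If $M$ is an object of ${}_A\mathcal{M}(\mathbf{H})^C$, and $E({}_AM^C)$ denotes its injective hull in the category ${}_A\mathcal{M}(\mathbf{H})^C$, then: (a) The map $$\zeta_M:M\to\mathrm{Hom}_{C^*}(\mathrm{Rat}^r_C({}_{C^*}C^* ),E({}_AM^C)),\qquad \zeta_M(m)(c^* )=c^*m\quad(m\in M,\ c^*\in\mathrm{Rat}^r_C({}_{C^*}C^* )),$$ gives an injective envelope of $M$ in ${}_{A\sharp C^*}\mathsf{Mod}$. (b) $M$ is injective in ${}_{A\sharp C^*}\mathsf{Mod}$ if and only if $M$ is injective in ${}_A\mathcal{M}(\mathbf{H})^C$ and $\zeta_M$ is an isomorphism. (c) Assume that the antipode of $\mathbf{H}$ is bijective, and that $C^*$ is flat as a $K$-module. Let $M$ be injective in ${}_A\mathcal{M}(\mathbf{H})^C$. If $M$ has finite support as a right $C$-comodule, then $M$ is injective as a left $A$-module.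
   Context: $A$ being a right $\mathbf{H}$-comodule algebra means that the coaction $\rho_A:A\to A\otimes_K\mathbf{H}$, $\rho_A(a)=\sum a_{(0)}\otimes a_{(1)}$, is a $K$-algebra map; $C$ being a left $\mathbf{H}$-module coalgebra means that the action $\mathbf{H}\otimes_K C\to C$ is a $K$-coalgebra map. $C_K$ is locally projective if for every finite subset $\{c_i\}\subseteq C$ there is a finite set $\{(c_l,x_l)\}\subseteq C\times C^*$ with $c_i=\sum_l c_lx_l(c_i)$ for all $i$. $C^*=\mathrm{Hom}_K(C,K)$ is the convolution algebra, $(xy)(c)=\sum x(c_{(1)})y(c_{(2)})$, with right $\mathbf{H}$-action $(xh)(c)=x(hc)$. The smash product $A\sharp C^*$ is $A\otimes_K C^*$ with product $(a\sharp x)(b\sharp y)=\sum ab_{(0)}\sharp(xb_{(1)})y$ and unit $1\sharp\varepsilon_C$; $A$ and $C^*$ map to it by the algebra maps $a\mapsto a\sharp\varepsilon_C$ and $x\mapsto1\sharp x$, and left $A\sharp C^*$-modules are left $C^*$-modules by restriction of scalars. For a left $C^*$-module $M$, $\mathrm{Rat}^r_C({}_{C^*}M)$ is the submodule of those $m\in M$ for which there is a finite set $\{(c_i,m_i)\}\subseteq C\times M$ with $xm=\sum_i m_ix(c_i)$ for all $x\in C^*$; $\mathrm{Rat}^r_C$ is a functor on left $C^*$-modules. ${}_A\mathcal{M}(\mathbf{H})^C$ is the category of Doi-Koppinen modules: left $A$-modules $M$ with a right $C$-comodule structure $\rho_M(m)=\sum m_{(0)}\otimes m_{(1)}$ such that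 $\rho_M(am)=\sum a_{(0)}m_{(0)}\otimes a_{(1)}m_{(1)}$; morphisms are left $A$-linear right $C$-colinear maps. A Doi-Koppinen module is a left $A\sharp C^*$-module via $(a\sharp x)m=\sum am_{(0)}x(m_{(1)})$, in particular $c^*m=\sum m_{(0)}c^*(m_{(1)})$ for $c^*\in C^*$. $M$ is regarded as a subobject of $E({}_AM^C)$. Under these hypotheses $\mathfrak{a}=A\otimes_K\mathrm{Rat}^r_C({}_{C^*}C^* )$ is a two-sided ideal of $A\sharp C^*$, and for every left $A\sharp C^*$-module $N$ the map $\mathrm{Hom}_{A\sharp C^*}(\mathfrak{a},N)\to\mathrm{Hom}_{C^*}(\mathrm{Rat}^r_C({}_{C^*}C^* ),N)$, $f\mapsto[c^*\mapsto f(1\otimes c^* )]$, is an isomorphism of $K$-modules. The left $A\sharp C^*$-module structure on $\mathrm{Hom}_{C^*}(\mathrm{Rat}^r_C({}_{C^*}C^* ),N)$ is the one transferred through this isomorphism from the structure $(sf)(x)=f(xs)$ ($s\in A\sharp C^*$, $x\in\mathfrak{a}$) on $\mathrm{Hom}_{A\sharp C^*}(\mathfrak{a},N)$. Finite support as a right $C$-comodule: it is understood that $\mathrm{Rat}^r_C({}_{C^*}C^* )$ has a set of local units, i.e. contains a set $E$ of commuting idempotents such that for every $x\in\mathrm{Rat}^r_C({}_{C^*}C^* )$ there is $e\in E$ with $xe=ex=x$; relative to such an $E$, a right $C$-comodule $M$ (a left $C^*$-module) has finite support if there is a finite subset $F\subseteq E$ with $\left(\sum_{e\in F}e\right)m=m$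 for every $m\in M$. *)

(* Defs.v *)
From HB Require Import structures.
From mathcomp Require Import all_boot all_order all_algebra.
From mathcomp Require Import boolp classical_sets functions.
From mathcomp Require Import generic_quotient.

Set Implicit Arguments.
Unset Strict Implicit.
Unset Printing Implicit Defensive.

Import GRing.Theory.
Local Open Scope ring_scope.
Local Open Scope quotient_scope.

Section TensorProduct.
Variables (K : comPzRingType) (M N : lmodType K).

Record balanced (P : zmodType) (f : M -> N -> P) : Prop := Balanced {
  balancedDl : forall n, {morph f^~ n : m m' / m + m'};
  balancedDr : forall m, {morph f m : n n' / n + n'};
  balancedZ : forall (k : K) m n, f (k *: m) n = f m (k *: n) }.

(* M (x) N is the set of finite formal sums of pairs, two sums being identified
   when every balanced map into an abelian group gives them the same value. *)
Definition tens_eqv (s t : seq (M * N)) : bool :=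
  `[< forall (P : zmodType) (f : M -> N -> P), balanced f ->
        \sum_(p <- s) f p.1 p.2 = \sum_(p <- t) f p.1 p.2 >].

Fact tens_eqv_refl : reflexive tens_eqv.
Proof. by move=> s; apply/asboolP. Qed.

Fact tens_eqv_sym : symmetric tens_eqv.
Proof. by move=> s t; apply/asboolP/asboolP => st P f fB; rewrite st. Qed.

Fact tens_eqv_trans : transitive tens_eqv.
Proof.
by move=> t s u /asboolP st /asboolP tu; apply/asboolP => P f fB; rewrite st ?tu.
Qed.

Canonical tens_equiv :=
  EquivRel tens_eqv tens_eqv_refl tens_eqv_sym tens_eqv_trans.

Definition tensor := {eq_quot tens_eqv}.
HB.instance Definition _ : EqQuotient _ tens_eqv tensor := EqQuotient.on tensor.
HB.instance Definition _ := Choice.on tensor.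

(* Sweedler notation: [\sum_(p <- sw t) f p.1 p.2] is the value at t of the map
   induced by f. For balanced f it does not depend on the representative of t
   (sw_pi, swD, sw_tens); sw is used with balanced f only. *)
Definition sw (t : tensor) : seq (M * N) := repr t.

Definition tens (m : M) (n : N) : tensor := \pi_tensor [:: (m, n)].

Lemma tens_ext (s t : seq (M * N)) :
  (forall (P : zmodType) (f : M -> N -> P), balanced f ->
     \sum_(p <- s) f p.1 p.2 = \sum_(p <- t) f p.1 p.2) ->
  \pi_tensor s = \pi_tensor t.
Proof. by move=> st; apply/eqquotP/asboolP. Qed.

Lemma sw_pi (P : zmodType) (f : M -> N -> P) (s : seq (M * N)) :
  balanced f ->
  \sum_(p <- sw (\pi_tensor s)) f p.1 p.2 = \sum_(p <- s) f p.1 p.2.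
Proof.
move=> fB; have : \pi_tensor (repr (\pi_tensor s)) = \pi_tensor s by rewrite reprK.
by move/eqquotP/asboolP => /(_ P f fB).
Qed.

Lemma sw_ext (t u : tensor) :
  (forall (P : zmodType) (f : M -> N -> P), balanced f ->
     \sum_(p <- sw t) f p.1 p.2 = \sum_(p <- sw u) f p.1 p.2) -> t = u.
Proof. by move=> tu; rewrite -[t]reprK -[u]reprK; apply: tens_ext. Qed.

Definition tens_add (t u : tensor) : tensor := \pi_tensor (sw t ++ sw u).
Definition tens_opp (t : tensor) : tensor :=
  \pi_tensor [seq (- p.1, p.2) | p <- sw t].
Definition tens_scale (k : K) (t : tensor) : tensor :=
  \pi_tensor [seq (k *: p.1, p.2) | p <- sw t].

Lemma balancedN (P : zmodType) (f : M -> N -> P) : balanced f ->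
  forall m n, f (- m) n = - f m n.
Proof.
move=> [fD _ _] m n; apply: (addrI (f m n)); rewrite -fD !subrr.
by apply: (addrI (f 0 n)); rewrite -fD !addr0.
Qed.

Lemma balanced_scale (P : zmodType) (f : M -> N -> P) k : balanced f ->
  balanced (fun m n => f (k *: m) n).
Proof.
move=> [fDl fDr fZ]; split=> [n m m'|m n n'|l m n]; rewrite ?scalerDr ?fDl ?fDr //.
by rewrite scalerA mulrC -scalerA fZ.
Qed.

Lemma sw_add0 (P : zmodType) (f : M -> N -> P) t u : balanced f ->
  \sum_(p <- sw (tens_add t u)) f p.1 p.2 =
  \sum_(p <- sw t) f p.1 p.2 + \sum_(p <- sw u) f p.1 p.2.
Proof. by move=> fB; rewrite sw_pi // big_cat. Qed.

Lemma sw_opp0 (P : zmodType) (f : M -> N -> P) t : balanced f ->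
  \sum_(p <- sw (tens_opp t)) f p.1 p.2 = - \sum_(p <- sw t) f p.1 p.2.
Proof.
move=> fB; rewrite sw_pi // big_map -sumrN /=.
by apply: eq_bigr => p _; rewrite balancedN.
Qed.

Lemma sw_scale0 (P : zmodType) (f : M -> N -> P) k t : balanced f ->
  \sum_(p <- sw (tens_scale k t)) f p.1 p.2 =
  \sum_(p <- sw t) f (k *: p.1) p.2.
Proof. by move=> fB; rewrite sw_pi // big_map. Qed.

Fact tens_addA : associative tens_add.
Proof. by move=> t u v; apply: sw_ext => P f fB; rewrite !sw_add0 // addrA. Qed.

Fact tens_addC : commutative tens_add.
Proof. by move=> t u; apply: sw_ext => P f fB; rewrite !sw_add0 // addrC. Qed.

Fact tens_add0 : left_id (\pi_tensor [::]) tens_add.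
Proof.
by move=> t; apply: sw_ext => P f fB; rewrite sw_add0 // sw_pi // big_nil add0r.
Qed.

Fact tens_addN : left_inverse (\pi_tensor [::]) tens_opp tens_add.
Proof.
move=> t; apply: sw_ext => P f fB.
by rewrite sw_add0 // sw_opp0 // addNr sw_pi // big_nil.
Qed.

HB.instance Definition _ :=
  GRing.isZmodule.Build tensor tens_addA tens_addC tens_add0 tens_addN.

Fact tens_scaleA a b t : tens_scale a (tens_scale b t) = tens_scale (a * b) t.
Proof.
apply: sw_ext => P f fB; rewrite !(sw_scale0 _ _ fB).
rewrite (sw_scale0 _ _ (balanced_scale a fB)).
by apply: eq_bigr => p _; rewrite scalerA.
Qed.

Fact tens_scale1 : left_id 1 tens_scale.
Proof.
move=> t; apply: sw_ext => P f fB; rewrite !sw_scale0 //.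
by apply: eq_bigr => p _; rewrite scale1r.
Qed.

Fact tens_scaleDr : right_distributive tens_scale +%R.
Proof.
move=> k t u; apply: sw_ext => P f fB; rewrite sw_add0 // !(sw_scale0 _ _ fB).
by rewrite (sw_add0 _ _ (balanced_scale k fB)).
Qed.

Fact tens_scaleDl t : {morph tens_scale^~ t : a b / a + b}.
Proof.
move=> a b; apply: sw_ext => P f fB; rewrite sw_scale0 // sw_add0 ?sw_scale0 //.
rewrite -big_split; apply: eq_bigr => p _; rewrite scalerDl.
exact: (balancedDl fB).
Qed.

HB.instance Definition _ := GRing.Zmodule_isLmodule.Build K tensor
  tens_scaleA tens_scale1 tens_scaleDr tens_scaleDl.

Section Evaluation.
Variables (P : zmodType) (f : M -> N -> P).
Hypothesis fB : balanced f.

Lemma swD t u : \sum_(p <- sw (t + u)) f p.1 p.2 =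
  \sum_(p <- sw t) f p.1 p.2 + \sum_(p <- sw u) f p.1 p.2.
Proof. exact: sw_add0. Qed.

Lemma sw0 : \sum_(p <- sw 0) f p.1 p.2 = 0.
Proof. by rewrite (_ : 0 = \pi_tensor [::]) // sw_pi // big_nil. Qed.

Lemma sw_sum I (r : seq I) (F : I -> tensor) :
  \sum_(p <- sw (\sum_(i <- r) F i)) f p.1 p.2 =
  \sum_(i <- r) \sum_(p <- sw (F i)) f p.1 p.2.
Proof. by elim: r => [|i r IHr]; rewrite ?big_nil ?sw0 // !big_cons swD IHr. Qed.

Lemma swZ k t : \sum_(p <- sw (k *: t)) f p.1 p.2 =
  \sum_(p <- sw t) f (k *: p.1) p.2.
Proof. exact: sw_scale0. Qed.

Lemma sw_tens m n : \sum_(p <- sw (tens m n)) f p.1 p.2 = f m n.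
Proof. by rewrite sw_pi // big_seq1. Qed.

End Evaluation.

Lemma tensDl m m' n : tens (m + m') n = tens m n + tens m' n.
Proof. by apply: sw_ext => P f fB; rewrite swD // !sw_tens // balancedDl. Qed.

Lemma tensDr m n n' : tens m (n + n') = tens m n + tens m n'.
Proof. by apply: sw_ext => P f fB; rewrite swD // !sw_tens // balancedDr. Qed.

Lemma tensZl k m n : tens (k *: m) n = k *: tens m n.
Proof.
apply: sw_ext => P f fB; rewrite swZ // sw_tens //.
by rewrite (sw_tens (balanced_scale k fB)).
Qed.

Lemma tensZr k m n : tens m (k *: n) = k *: tens m n.
Proof. by rewrite -tensZl; apply: sw_ext => P f fB; rewrite !sw_tens // balancedZ. Qed.

Lemma tens_balanced : balanced tens.
Proof.
by split=> [n m m'|m n n'|k m n] /=; rewrite ?tensDl ?tensDr ?tensZl ?tensZr.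
Qed.

Lemma sw_pi_sum s : \pi_tensor s = \sum_(p <- s) tens p.1 p.2.
Proof.
by apply: sw_ext => P f fB; rewrite sw_pi // sw_sum //;
   apply: eq_bigr => p _; rewrite sw_tens.
Qed.

Lemma swK t : \sum_(p <- sw t) tens p.1 p.2 = t.
Proof. by rewrite -sw_pi_sum reprK. Qed.

Lemma tens0l n : tens 0 n = 0.
Proof. by apply: (addrI (tens 0 n)); rewrite -tensDl !addr0. Qed.

Lemma tens0r m : tens m 0 = 0.
Proof. by apply: (addrI (tens m 0)); rewrite -tensDr !addr0. Qed.

Lemma tens_suml I (r : seq I) (F : I -> M) n :
  tens (\sum_(i <- r) F i) n = \sum_(i <- r) tens (F i) n.
Proof.
by elim: r => [|i r IHr]; rewrite ?big_nil ?tens0l // !big_cons tensDl IHr.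
Qed.

Lemma tens_sumr I (r : seq I) m (F : I -> N) :
  tens m (\sum_(i <- r) F i) = \sum_(i <- r) tens m (F i).
Proof.
by elim: r => [|i r IHr]; rewrite ?big_nil ?tens0r // !big_cons tensDr IHr.
Qed.

Lemma tens_ind (Q : tensor -> Prop) :
  (forall m n, Q (tens m n)) -> Q 0 -> (forall t u, Q t -> Q u -> Q (t + u)) ->
  forall t, Q t.
Proof.
by move=> Qt Q0 QD t; rewrite -[t]swK; elim/big_ind: _ => // p _; apply: Qt.
Qed.

End TensorProduct.

Arguments tensor {K} M N.
Notation "M \tens N" := (tensor M N) (at level 40, left associativity) : type_scope.
Notation "m \ten n" := (tens m n) (at level 40, left associativity) : ring_scope.
Notation "m \ten[ M , N ] n" := (@tens _ M N m n)
  (at level 40, left associativity, only parsing) : ring_scope.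

Section LinearMaps.
Variables (R : pzRingType) (U V : lmodType R).

Lemma linear_ext (f g : {linear U -> V}) : f =1 g -> f = g.
Proof.
case: f g => [f [[fa] [fs]]] [g [[ga] [gs]]] /= fg.
have {fg} fg : f = g by apply/funext.
by subst g; rewrite (Prop_irrelevance fa ga) (Prop_irrelevance fs gs).
Qed.

HB.instance Definition _ := gen_eqMixin {linear U -> V}.
HB.instance Definition _ := gen_choiceMixin {linear U -> V}.

Let lin_add (f g : {linear U -> V}) : {linear U -> V} := f \+ g.
Let lin_opp (f : {linear U -> V}) : {linear U -> V} := \- f.
Let lin_zero : {linear U -> V} := \0.

Let lin_addA : associative lin_add.
Proof. by move=> f g h; apply: linear_ext => x; apply: addrA. Qed.
Let lin_addC : commutative lin_add.
Proof. by move=> f g; apply: linear_ext => x; apply: addrC. Qed.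
Let lin_add0 : left_id lin_zero lin_add.
Proof. by move=> f; apply: linear_ext => x; apply: add0r. Qed.
Let lin_addN : left_inverse lin_zero lin_opp lin_add.
Proof. by move=> f; apply: linear_ext => x; apply: addNr. Qed.

HB.instance Definition _ :=
  GRing.isZmodule.Build {linear U -> V} lin_addA lin_addC lin_add0 lin_addN.

Lemma lin_sumE I (r : seq I) (F : I -> {linear U -> V}) u :
  (\sum_(i <- r) F i) u = \sum_(i <- r) F i u.
Proof. by elim: r => [|i r IHr]; rewrite ?big_nil // !big_cons -IHr. Qed.

End LinearMaps.

Section LinearMapsCom.
Variables (K : comPzRingType) (U V : lmodType K).

Let lin_scale (k : K) (f : {linear U -> V}) : {linear U -> V} := k \*: f.

Let lin_scaleA a b f : lin_scale a (lin_scale b f) = lin_scale (a * b) f.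
Proof. by apply: linear_ext => x; apply: scalerA. Qed.
Let lin_scale1 : left_id 1 lin_scale.
Proof. by move=> f; apply: linear_ext => x; apply: scale1r. Qed.
Let lin_scaleDr : right_distributive lin_scale +%R.
Proof. by move=> k f g; apply: linear_ext => x; apply: scalerDr. Qed.
Let lin_scaleDl f : {morph lin_scale^~ f : a b / a + b}.
Proof. by move=> a b; apply: linear_ext => x; apply: scalerDl. Qed.

HB.instance Definition _ := GRing.Zmodule_isLmodule.Build K {linear U -> V}
  lin_scaleA lin_scale1 lin_scaleDr lin_scaleDl.

End LinearMapsCom.

Definition rscalars (R S : pzRingType) (phi : {rmorphism R -> S})
  (M : lmodType S) : Type := M.

Section Restriction.
Variables (R S : pzRingType) (phi : {rmorphism R -> S}) (M : lmodType S).

Local Notation rscalars := (rscalars phi M).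
HB.instance Definition _ := GRing.Zmodule.copy rscalars M.

Let rscale (r : R) (m : rscalars) : rscalars := phi r *: (m : M).
Let rscaleA a b m : rscale a (rscale b m) = rscale (a * b) m.
Proof. by rewrite /rscale scalerA rmorphM. Qed.
Let rscale1 : left_id 1 rscale.
Proof. by move=> m; rewrite /rscale rmorph1 scale1r. Qed.
Let rscaleDr : right_distributive rscale +%R.
Proof. by move=> a m n; apply: scalerDr. Qed.
Let rscaleDl m : {morph rscale^~ m : a b / a + b}.
Proof. by move=> a b; rewrite /rscale rmorphD; apply: scalerDl. Qed.

HB.instance Definition _ :=
  GRing.Zmodule_isLmodule.Build R rscalars rscaleA rscale1 rscaleDr rscaleDl.

End Restriction.

(* A K-algebra, given by its structure map into the centre. The library's algType
   would exclude the zero ring, whereas A may be zero. *)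
Record kalgebra (K : comPzRingType) := KAlgebra {
  kalg_ring :> pzRingType;
  kscal : {rmorphism K -> kalg_ring};
  kscalC : forall (k : K) (a : kalg_ring), kscal k * a = a * kscal k }.

(* The K-modules underlying a K-algebra A and a left A-module M. *)
Notation kmod A := (rscalars (kscal A) (A : pzRingType)^o).
Notation kres M := (rscalars (kscal _) M).

Section ModuleNotions.
Variable R : pzRingType.

Definition injective_module (E : lmodType R) : Prop :=
  forall (U V : lmodType R) (i : {linear U -> V}) (f : {linear U -> E}),
    injective i -> exists g : {linear V -> E}, forall u, g (i u) = f u.

Definition submodule (E : lmodType R) (X : set E) : Prop :=
  [/\ X 0, forall x y, X x -> X y -> X (x + y) & forall r x, X x -> X (r *: x)].

Definition essential_mono (M E : lmodType R) (i : M -> E) : Prop :=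
  [/\ linear i, injective i &
      forall X : set E, submodule X -> (forall m, X (i m) -> m = 0) ->
        forall x, X x -> x = 0].

Definition injective_envelope (M E : lmodType R) (i : M -> E) : Prop :=
  essential_mono i /\ injective_module E.

Definition module_iso (M E : lmodType R) (i : M -> E) : Prop :=
  linear i /\ bijective i.

Definition short_exact (L M N : lmodType R)
    (f : {linear L -> M}) (g : {linear M -> N}) : Prop :=
  [/\ injective f, forall m, g m = 0 <-> (exists l, f l = m) &
      forall n, exists m, g m = n].

End ModuleNotions.

Section FlatProjective.
Variable K : comPzRingType.

Definition tmap (M N M' N' : lmodType K) (f : M -> M') (g : N -> N')
    (t : M \tens N) : M' \tens N' := \sum_(p <- sw t) f p.1 \ten g p.2.

Definition flat (M : lmodType K) : Prop :=
  forall (U V : lmodType K) (f : {linear U -> V}), injective f ->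
    injective (tmap (M := M) id f).

Definition locally_projective (C : lmodType K) : Prop :=
  forall F : seq C, exists s : seq (C * {linear C -> K^o}),
    forall c, c \in F -> c = \sum_(p <- s) (p.2 c : K) *: p.1.

End FlatProjective.

Section HopfAlgebras.
Variable K : comPzRingType.

Record is_coalgebra (C : lmodType K) (Delta : {linear C -> C \tens C})
    (eps : {linear C -> K^o}) : Prop := IsCoalgebra {
  comulA : forall c,
    \sum_(p <- sw (Delta c)) \sum_(q <- sw (Delta p.1)) q.1 \ten (q.2 \ten p.2) =
    \sum_(p <- sw (Delta c)) \sum_(q <- sw (Delta p.2)) p.1 \ten (q.1 \ten q.2);
  counitl : forall c, \sum_(p <- sw (Delta c)) (eps p.1 : K) *: p.2 = c;
  counitr : forall c, \sum_(p <- sw (Delta c)) (eps p.2 : K) *: p.1 = c }.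

Record coalgebra := Coalgebra {
  coalg_mod :> lmodType K;
  comul : {linear coalg_mod -> coalg_mod \tens coalg_mod};
  counit : {linear coalg_mod -> K^o};
  coalgP : is_coalgebra comul counit }.

Record is_comodule (C : coalgebra) (M : lmodType K)
    (rho : {linear M -> M \tens C}) : Prop := IsComodule {
  coactA : forall m,
    \sum_(p <- sw (rho m)) \sum_(q <- sw (rho p.1)) q.1 \ten (q.2 \ten p.2) =
    \sum_(p <- sw (rho m)) \sum_(q <- sw (comul C p.2)) p.1 \ten (q.1 \ten q.2);
  coact_counit : forall m, \sum_(p <- sw (rho m)) (counit C p.2 : K) *: p.1 = m }.

Record hopf_algebra := HopfAlgebra {
  hopf_alg :> kalgebra K;
  hopf_comul : {linear kmod hopf_alg -> kmod hopf_alg \tens kmod hopf_alg};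
  hopf_counit : {linear kmod hopf_alg -> K^o};
  hopf_coalgP : is_coalgebra hopf_comul hopf_counit;
  hopf_comul1 : hopf_comul (1 : hopf_alg) = (1 : hopf_alg) \ten[kmod hopf_alg, kmod hopf_alg] (1 : hopf_alg);
  hopf_comulM : forall g h : hopf_alg, hopf_comul (g * h) =
    \sum_(p <- sw (hopf_comul g)) \sum_(q <- sw (hopf_comul h))
      ((p.1 : hopf_alg) * q.1) \ten[kmod hopf_alg, kmod hopf_alg] ((p.2 : hopf_alg) * q.2);
  hopf_counit1 : hopf_counit (1 : hopf_alg) = 1 :> K;
  hopf_counitM : forall g h : hopf_alg,
    hopf_counit (g * h) = (hopf_counit g : K) * hopf_counit h;
  antipode : {linear kmod hopf_alg -> kmod hopf_alg};
  antipodel : forall h,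
    \sum_(p <- sw (hopf_comul h)) (antipode p.1 : hopf_alg) * p.2 =
    kscal hopf_alg (hopf_counit h);
  antipoder : forall h,
    \sum_(p <- sw (hopf_comul h)) (p.1 : hopf_alg) * antipode p.2 =
    kscal hopf_alg (hopf_counit h) }.

Definition hopf_coalg (H : hopf_algebra) : coalgebra :=
  Coalgebra (hopf_coalgP H).

Record comodule_algebra (H : hopf_algebra) := ComoduleAlgebra {
  ca_alg :> kalgebra K;
  ca_coact : {linear kmod ca_alg -> kmod ca_alg \tens hopf_coalg H};
  ca_comodule : is_comodule ca_coact;
  ca_coact1 : ca_coact (1 : ca_alg) = (1 : ca_alg) \ten[kmod ca_alg, hopf_coalg H] (1 : H);
  ca_coactM : forall a b : ca_alg, ca_coact (a * b) =
    \sum_(p <- sw (ca_coact a)) \sum_(q <- sw (ca_coact b))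
      ((p.1 : ca_alg) * q.1) \ten[kmod ca_alg, hopf_coalg H] ((p.2 : H) * q.2) }.

Record module_coalgebra (H : hopf_algebra) := ModuleCoalgebra {
  mc_coalg :> coalgebra;
  hact : H -> mc_coalg -> mc_coalg;
  hact_linearl : forall c, linear (hact^~ c : kmod H -> mc_coalg);
  hact_linearr : forall h, linear (hact h);
  hact1 : forall c, hact 1 c = c;
  hactA : forall g h c, hact (g * h) c = hact g (hact h c);
  hact_comul : forall h c, comul mc_coalg (hact h c) =
    \sum_(p <- sw (comul (hopf_coalg H) h)) \sum_(q <- sw (comul mc_coalg c))
      hact p.1 q.1 \ten hact p.2 q.2;
  hact_counit : forall h c,
    counit mc_coalg (hact h c) = (hopf_counit H h : K) * counit mc_coalg c }.

End HopfAlgebras.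

Section TriLinear.
Variables (K : comPzRingType) (X Y Z : lmodType K) (P : zmodType).
Variable f : X -> Y -> Z -> P.
Hypothesis fl : forall x, balanced (f x).
Hypothesis fr : forall z, balanced (fun x y => f x y z).

Lemma trilinear_eval :
  balanced (fun x (t : Y \tens Z) => \sum_(q <- sw t) f x q.1 q.2).
Proof.
split=> [t x x'|x t t'|k x t].
- by rewrite -big_split; apply: eq_bigr => q _; rewrite (balancedDl (fr _)).
- exact: (swD (fl x)).
- by rewrite (swZ (fl x)); apply: eq_bigr => q _; rewrite (balancedZ (fr _)).
Qed.

Lemma sw_trilinear I J (r : seq I) (s : I -> seq J)
    (F : I -> J -> X) (G : I -> J -> Y) (H : I -> J -> Z) :
  let t := \sum_(i <- r) \sum_(j <- s i) F i j \ten (G i j \ten H i j) in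
  \sum_(p <- sw t) \sum_(q <- sw p.2) f p.1 q.1 q.2 =
  \sum_(i <- r) \sum_(j <- s i) f (F i j) (G i j) (H i j).
Proof.
rewrite /= (sw_sum trilinear_eval); apply: eq_bigr => i _.
rewrite (sw_sum trilinear_eval); apply: eq_bigr => j _.
by rewrite (sw_tens trilinear_eval) sw_tens.
Qed.

End TriLinear.

Lemma coaction_trilinear (K : comPzRingType) (C : coalgebra K) (M : lmodType K)
    (rho : {linear M -> M \tens C}) (P : zmodType) (f : M -> C -> C -> P) m :
  is_comodule rho ->
  (forall x, balanced (f x)) -> (forall z, balanced (fun x y => f x y z)) ->
  \sum_(p <- sw (rho m)) \sum_(q <- sw (rho p.1)) f q.1 q.2 p.2 =
  \sum_(p <- sw (rho m)) \sum_(q <- sw (comul C p.2)) f p.1 q.1 q.2.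
Proof.
move=> rhoC fl fr.
have := congr1 (fun t => \sum_(p <- sw t) \sum_(q <- sw p.2) f p.1 q.1 q.2)
  (coactA rhoC m).
by rewrite !(sw_trilinear fl fr).
Qed.

Lemma comul_trilinear (K : comPzRingType) (C : coalgebra K) (P : zmodType)
    (f : C -> C -> C -> P) c :
  (forall x, balanced (f x)) -> (forall z, balanced (fun x y => f x y z)) ->
  \sum_(p <- sw (comul C c)) \sum_(q <- sw (comul C p.1)) f q.1 q.2 p.2 =
  \sum_(p <- sw (comul C c)) \sum_(q <- sw (comul C p.2)) f p.1 q.1 q.2.
Proof.
move=> fl fr.
have := congr1 (fun t => \sum_(p <- sw t) \sum_(q <- sw p.2) f p.1 q.1 q.2)
  (comulA (coalgP C) c).
by rewrite !(sw_trilinear fl fr).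
Qed.

Section Dual.
Variables (K : comPzRingType) (C : coalgebra K).

(* The convolution algebra. *)
Definition dual : Type := {linear C -> K^o}.
HB.instance Definition _ := GRing.Lmodule.copy dual {linear C -> K^o}.

Definition dapp (x : dual) (c : C) : K := (x : {linear C -> K^o}) c.
Coercion dapp : dual >-> Funclass.

Lemma dual_ext (x y : dual) : (forall c, x c = y c) -> x = y.
Proof. exact: (@linear_ext K C K^o x y). Qed.

Lemma dappDr (x : dual) c d : x (c + d) = x c + x d.
Proof. exact: (linearD (x : {linear C -> K^o})). Qed.
Lemma dappZr (x : dual) k c : x (k *: c) = k * x c.
Proof. exact: (linearZZ (x : {linear C -> K^o})). Qed.
Lemma dappDl (x y : dual) c : (x + y : dual) c = x c + y c. Proof. by []. Qed.
Lemma dappZl k (x : dual) c : (k *: x : dual) c = k * x c. Proof. by []. Qed.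
Lemma dapp_sumr (x : dual) I (r : seq I) (F : I -> C) :
  x (\sum_(i <- r) F i) = \sum_(i <- r) x (F i).
Proof. exact: (linear_sum (x : {linear C -> K^o})). Qed.
Lemma dapp_suml I (r : seq I) (F : I -> dual) c :
  (\sum_(i <- r) F i : dual) c = \sum_(i <- r) F i c.
Proof. by elim: r => [|i r IHr]; rewrite ?big_nil // !big_cons dappDl IHr. Qed.

Lemma dual_balanced (x y : dual) : balanced (fun c d : C => x c * y d).
Proof.
split=> [d c c'|c d d'|k c d]; rewrite ?dappDr ?mulrDl ?mulrDr //.
by rewrite !dappZr mulrCA mulrA.
Qed.

Definition conv_fun (x y : dual) (c : C) : K^o :=
  \sum_(p <- sw (comul C c)) x p.1 * y p.2.

Fact conv_linear x y : linear (conv_fun x y).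
Proof.
move=> k c d; rewrite /conv_fun linearP (swD (dual_balanced x y)).
rewrite (swZ (dual_balanced x y)) scaler_sumr; congr (_ + _).
by apply: eq_bigr => p _; rewrite dappZr -mulrA.
Qed.

HB.instance Definition _ x y :=
  GRing.isLinear.Build K C K^o *:%R (conv_fun x y) (conv_linear x y).

Definition conv (x y : dual) : dual := (conv_fun x y : {linear C -> K^o}).
Definition dual_unit : dual := counit C.

Lemma convE x y c : (conv x y : dual) c = \sum_(p <- sw (comul C c)) x p.1 * y p.2.
Proof. by []. Qed.

Fact convA : associative conv.
Proof.
move=> x y z; apply: dual_ext => c; rewrite !convE.
pose f a b d := x a * (y b * z d).
under eq_bigr do rewrite convE mulr_sumr.
rewrite -[LHS](comul_trilinear (f := f)).
- apply: eq_bigr => p _; rewrite convE mulr_suml; apply: eq_bigr => q _.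
  by rewrite /f mulrA.
- move=> a; split=> [d c' c''|c' d d'|k c' d]; rewrite /f ?dappDr ?mulrDl ?mulrDr //.
  by rewrite !dappZr -!mulrA [k * (_ * _)]mulrCA.
- move=> a; split=> [d c' c''|c' d d'|k c' d]; rewrite /f ?dappDr ?mulrDl ?mulrDr //.
  by rewrite !dappZr -!mulrA mulrCA.
Qed.

Fact conv1l : left_id dual_unit conv.
Proof.
move=> x; apply: dual_ext => c; rewrite convE -[in RHS](counitl (coalgP C) c) dapp_sumr.
by apply: eq_bigr => p _; rewrite dappZr.
Qed.

Fact conv1r : right_id dual_unit conv.
Proof.
move=> x; apply: dual_ext => c; rewrite convE -[in RHS](counitr (coalgP C) c) dapp_sumr.
by apply: eq_bigr => p _; rewrite dappZr mulrC.
Qed.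

Fact convDl : left_distributive conv +%R.
Proof.
move=> x y z; apply: dual_ext => c; rewrite dappDl !convE -big_split.
by apply: eq_bigr => p _; rewrite dappDl mulrDl.
Qed.

Fact convDr : right_distributive conv +%R.
Proof.
move=> x y z; apply: dual_ext => c; rewrite dappDl !convE -big_split.
by apply: eq_bigr => p _; rewrite dappDl mulrDr.
Qed.

HB.instance Definition _ := GRing.Zmodule_isPzRing.Build dual
  convA conv1l conv1r convDl convDr.

Lemma dualM (x y : dual) c :
  (x * y : dual) c = \sum_(p <- sw (comul C c)) x p.1 * y p.2.
Proof. by []. Qed.

Lemma dual_scalerAl k (x y : dual) : k *: (x * y) = k *: x * y.
Proof.
apply: dual_ext => c; rewrite dappZl !dualM mulr_sumr.
by apply: eq_bigr => p _; rewrite dappZl mulrA.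
Qed.

Lemma dual_scalerAr k (x y : dual) : k *: (x * y) = x * (k *: y).
Proof.
apply: dual_ext => c; rewrite dappZl !dualM mulr_sumr.
by apply: eq_bigr => p _; rewrite dappZl mulrCA.
Qed.

Definition dual_scal (k : K) : dual := k *: (1 : dual).

Fact dual_scal_nmod : GRing.nmod_morphism dual_scal.
Proof. by split=> [|k l]; rewrite /dual_scal ?scale0r ?scalerDl. Qed.
Fact dual_scal_monoid : GRing.monoid_morphism dual_scal.
Proof.
by split=> [|k l]; rewrite /dual_scal ?scale1r // -dual_scalerAl mul1r scalerA.
Qed.
HB.instance Definition _ := GRing.isNmodMorphism.Build K dual dual_scal dual_scal_nmod.
HB.instance Definition _ :=
  GRing.isMonoidMorphism.Build K dual dual_scal dual_scal_monoid.

Lemma dual_scalE k x : dual_scal k * x = k *: x.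
Proof. by rewrite -dual_scalerAl mul1r. Qed.
Lemma dual_scalEr k x : x * dual_scal k = k *: x.
Proof. by rewrite -dual_scalerAr mulr1. Qed.

End Dual.

Arguments dapp : simpl never.

Lemma kmod_scaleE (K : comPzRingType) (A : kalgebra K) (k : K) (a : kmod A) :
  k *: a = kscal A k * (a : A) :> A.
Proof. by []. Qed.

Lemma hopf_scaleE (K : comPzRingType) (H : hopf_algebra K) (k : K)
  (h : hopf_coalg H) : k *: h = kscal H k * (h : H) :> H.
Proof. by []. Qed.

Lemma kscalCA (K : comPzRingType) (A : kalgebra K) (k : K) (a b : A) :
  a * (kscal A k * b) = kscal A k * (a * b).
Proof. by rewrite mulrA -kscalC mulrA. Qed.

Section Smash.
Variables (K : comPzRingType) (H : hopf_algebra K).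
Variables (A : comodule_algebra H) (C : module_coalgebra H).
Implicit Types (h g : H) (a b : A) (x y z : dual C) (c : C).

Lemma hactDl g h c : hact (g + h) c = hact g c + hact h c.
Proof. by have := hact_linearl c 1 g h; rewrite !scale1r. Qed.
Lemma hact0l c : hact (0 : H) c = 0.
Proof. by apply: (addrI (hact 0 c)); rewrite -hactDl !addr0. Qed.
Lemma hactZl k h c : hact (kscal H k * h) c = k *: hact h c.
Proof. by have := hact_linearl c k h 0; rewrite hact0l !addr0. Qed.
Lemma hactDr h c c' : hact h (c + c') = hact h c + hact h c'.
Proof. by have := hact_linearr h 1 c c'; rewrite !scale1r. Qed.
Lemma hact0r h : hact h (0 : C) = 0.
Proof. by apply: (addrI (hact h 0)); rewrite -hactDr !addr0. Qed.
Lemma hactZr k h c : hact h (k *: c) = k *: hact h c.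
Proof. by have := hact_linearr h k c 0; rewrite hact0r !addr0. Qed.

(* (x h)(c) = x (h c) *)
Definition dact_fun x h (c : C) : K^o := x (hact h c).

Fact dact_linear x h : linear (dact_fun x h).
Proof. by move=> k c d; rewrite /dact_fun hactDr hactZr dappDr dappZr. Qed.

HB.instance Definition _ x h :=
  GRing.isLinear.Build K C K^o *:%R (dact_fun x h) (dact_linear x h).

Definition dact x h : dual C := (dact_fun x h : {linear C -> K^o}).

Lemma dactE x h c : dact x h c = x (hact h c). Proof. by []. Qed.

Lemma dactDl x y h : dact (x + y) h = dact x h + dact y h.
Proof. by apply: dual_ext => c; rewrite dactE !dappDl. Qed.
Lemma dactZl k x h : dact (k *: x) h = k *: dact x h.
Proof. by apply: dual_ext => c; rewrite dactE !dappZl. Qed.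
Lemma dactDr x g h : dact x (g + h) = dact x g + dact x h.
Proof. by apply: dual_ext => c; rewrite dappDl !dactE hactDl dappDr. Qed.
Lemma dactZr k x h : dact x (kscal H k * h) = k *: dact x h.
Proof. by apply: dual_ext => c; rewrite dappZl !dactE hactZl dappZr. Qed.
Lemma dact1 x : dact x 1 = x.
Proof. by apply: dual_ext => c; rewrite dactE hact1. Qed.
Lemma dactA x g h : dact (dact x g) h = dact x (g * h).
Proof. by apply: dual_ext => c; rewrite !dactE hactA. Qed.

Lemma dact_suml I (r : seq I) (F : I -> dual C) h :
  dact (\sum_(i <- r) F i) h = \sum_(i <- r) dact (F i) h.
Proof.
elim: r => [|i r IHr]; last by rewrite !big_cons dactDl IHr.
by rewrite !big_nil; apply: (addrI (dact 0 h)); rewrite -dactDl !addr0.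
Qed.
Lemma dact_sumr I (r : seq I) x (F : I -> H) :
  dact x (\sum_(i <- r) F i) = \sum_(i <- r) dact x (F i).
Proof.
elim: r => [|i r IHr]; last by rewrite !big_cons dactDr IHr.
by rewrite !big_nil; apply: (addrI (dact x 0)); rewrite -dactDr !addr0.
Qed.

Lemma dact_unit h : dact 1 h = hopf_counit H h *: (1 : dual C).
Proof. by apply: dual_ext => c; rewrite dappZl dactE; apply: hact_counit. Qed.

Lemma dactM x y h :
  dact (x * y) h = \sum_(p <- sw (hopf_comul H h)) dact x p.1 * dact y p.2.
Proof.
apply: dual_ext => c; rewrite dapp_suml dactE dualM hact_comul.
rewrite (sw_sum (dual_balanced x y)); apply: eq_bigr => p _.
rewrite (sw_sum (dual_balanced x y)) dualM; apply: eq_bigr => q _.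
by rewrite (sw_tens (dual_balanced x y)).
Qed.

Definition smash : Type := kmod A \tens dual C.
HB.instance Definition _ := GRing.Zmodule.copy smash (kmod A \tens dual C).

(* The element a # x. *)
Definition smelt (a : A) (x : dual C) : smash := a \ten[kmod A, dual C] x.

Definition smash_mul (s t : smash) : smash :=
  \sum_(p <- sw s) \sum_(q <- sw t) \sum_(r <- sw (ca_coact A (q.1 : kmod A)))
     smelt ((p.1 : A) * r.1) (dact p.2 r.2 * q.2).

Definition smash_one : smash := smelt 1 1.

Lemma smeltDl a b x : smelt (a + b) x = smelt a x + smelt b x.
Proof. exact: tensDl. Qed.
Lemma smeltDr a x y : smelt a (x + y) = smelt a x + smelt a y.
Proof. exact: tensDr. Qed.
Lemma smeltZ k a x : smelt (kscal A k * a) x = smelt a (k *: x).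
Proof. by rewrite /smelt tensZr -tensZl. Qed.
Lemma smelt_suml I (r : seq I) (F : I -> A) x :
  smelt (\sum_(i <- r) F i) x = \sum_(i <- r) smelt (F i) x.
Proof. exact: tens_suml. Qed.
Lemma smelt_sumr I (r : seq I) a (F : I -> dual C) :
  smelt a (\sum_(i <- r) F i) = \sum_(i <- r) smelt a (F i).
Proof. exact: tens_sumr. Qed.

Let core a x b y : smash :=
  \sum_(r <- sw (ca_coact A (b : kmod A))) smelt (a * r.1) (dact x r.2 * y).

Fact core_bal a x y :
  balanced (fun (r : kmod A) (h : kmod H) => smelt (a * r) (dact x h * y)).
Proof.
split=> [h r r'|r h h'|k r h].
- by rewrite /= mulrDr smeltDl.
- by rewrite /= dactDr mulrDl smeltDr.
- by rewrite ?kmod_scaleE ?hopf_scaleE kscalCA smeltZ dactZr dual_scalerAl.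
Qed.

Fact core_ball b y : balanced (fun (a : kmod A) x => core a x b y).
Proof.
split=> [x a a'|a x x'|k a x]; rewrite /core -?big_split;
  apply: eq_bigr => r _ /=.
- by rewrite mulrDl smeltDl.
- by rewrite dactDl mulrDl smeltDr.
- by rewrite kmod_scaleE -mulrA smeltZ dactZl dual_scalerAl.
Qed.

Fact core_balr a x : balanced (fun (b : kmod A) y => core a x b y).
Proof.
split=> [y b b'|b y y'|k b y]; rewrite /core.
- by rewrite linearD (swD (core_bal a x y)).
- by rewrite -big_split; apply: eq_bigr => r _ /=; rewrite mulrDr smeltDr.
- rewrite linearZ (swZ (core_bal a x y)); apply: eq_bigr => r _.
  by rewrite kmod_scaleE kscalCA smeltZ dual_scalerAr.
Qed.

Fact core_sum_bal (t : smash) :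
  balanced (fun (a : kmod A) x => \sum_(q <- sw t) core a x q.1 q.2).
Proof.
split=> [x a a'|a x x'|k a x]; rewrite -?big_split; apply: eq_bigr => q _.
- exact: (balancedDl (core_ball _ _)).
- exact: (balancedDr (core_ball _ _)).
- exact: (balancedZ (core_ball _ _)).
Qed.

Fact smash_mulDl : left_distributive smash_mul +%R.
Proof. by move=> s s' t; apply: (swD (core_sum_bal t)). Qed.

Fact smash_mulDr : right_distributive smash_mul +%R.
Proof.
move=> s t t'; rewrite /smash_mul -big_split; apply: eq_bigr => p _.
exact: (swD (core_balr p.1 p.2)).
Qed.

Lemma smash_mul_elt a x b y : smash_mul (smelt a x) (smelt b y) =
  \sum_(r <- sw (ca_coact A (b : kmod A))) smelt (a * r.1) (dact x r.2 * y).
Proof.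
by rewrite /smash_mul (sw_tens (core_sum_bal _)) (sw_tens (core_balr a x)).
Qed.

Lemma smash_mul0l t : smash_mul 0 t = 0.
Proof. by apply: (addrI (smash_mul 0 t)); rewrite -smash_mulDl !addr0. Qed.
Lemma smash_mul0r t : smash_mul t 0 = 0.
Proof. by apply: (addrI (smash_mul t 0)); rewrite -smash_mulDr !addr0. Qed.
Lemma smash_mul_suml I (r : seq I) (F : I -> smash) t :
  smash_mul (\sum_(i <- r) F i) t = \sum_(i <- r) smash_mul (F i) t.
Proof.
by elim: r => [|i r IHr]; rewrite ?big_nil ?smash_mul0l // !big_cons smash_mulDl IHr.
Qed.
Lemma smash_mul_sumr I (r : seq I) (F : I -> smash) t :
  smash_mul t (\sum_(i <- r) F i) = \sum_(i <- r) smash_mul t (F i).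
Proof.
by elim: r => [|i r IHr]; rewrite ?big_nil ?smash_mul0r // !big_cons smash_mulDr IHr.
Qed.

Lemma smash_ind (Q : smash -> Prop) :
  (forall a x, Q (smelt a x)) -> Q 0 -> (forall s t, Q s -> Q t -> Q (s + t)) ->
  forall s, Q s.
Proof. exact: (@tens_ind K (kmod A) (dual C)). Qed.

Fact smash_mulA : associative smash_mul.
Proof.
move=> s t u; elim/smash_ind: s => [a x||s s' IHs IHs'].
- elim/smash_ind: t => [b y||t t' IHt IHt'].
  + elim/smash_ind: u => [b' z||u u' IHu IHu'].
    * rewrite !smash_mul_elt smash_mul_suml smash_mul_sumr.
      transitivity (\sum_(p <- sw (ca_coact A (b' : kmod A)))
         \sum_(r <- sw (ca_coact A (b : kmod A))) \sum_(q <- sw (ca_coact A p.1))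
            smelt (a * ((r.1 : A) * q.1)) (dact x ((r.2 : H) * q.2) * (dact y p.2 * z))).
        apply: eq_bigr => p _; rewrite smash_mul_elt ca_coactM.
        rewrite (sw_sum (core_bal _ _ _)); apply: eq_bigr => r _.
        rewrite (sw_sum (core_bal _ _ _)); apply: eq_bigr => q _.
        by rewrite (sw_tens (core_bal _ _ _)).
      rewrite exchange_big; apply: eq_bigr => r _.
      rewrite (coaction_trilinear (f := fun (a1 : kmod A) (h1 h2 : hopf_coalg H) => smelt (a * ((r.1 : A) * a1))
         (dact x ((r.2 : H) * h1) * (dact y h2 * z))) _ (ca_comodule A)).
      - rewrite smash_mul_elt; apply: eq_bigr => p _.
        rewrite dactM mulr_suml smelt_sumr; apply: eq_bigr => q _.
        by rewrite !mulrA dactA.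
      - move=> a1; split=> [h2 h h'|h1 h h'|k h1 h2] /=.
        + by rewrite mulrDr dactDr mulrDl smeltDr.
        + by rewrite dactDr mulrDl mulrDr smeltDr.
        + rewrite ?kmod_scaleE ?hopf_scaleE kscalCA !dactZr.
          by rewrite -!dual_scalerAl -dual_scalerAr.
      - move=> h2; split=> [h1 a1 a1'|a1 h h'|k a1 h1] /=.
        + by rewrite !mulrDr smeltDl.
        + by rewrite mulrDr dactDr mulrDl smeltDr.
        + by rewrite ?kmod_scaleE ?hopf_scaleE !kscalCA smeltZ dactZr -dual_scalerAl.
    * by rewrite !smash_mul0r.
    * by rewrite !smash_mulDr IHu IHu'.
  + by rewrite !(smash_mul0r, smash_mul0l).
  + by rewrite !(smash_mulDr, smash_mulDl) IHt IHt'.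
- by rewrite !smash_mul0l.
- by rewrite !smash_mulDl IHs IHs'.
Qed.

Fact smash_mul1l : left_id smash_one smash_mul.
Proof.
elim/smash_ind=> [a x||s t IHs IHt]; rewrite ?smash_mul0r ?smash_mulDr ?IHs ?IHt //.
rewrite smash_mul_elt -[RHS]/(smelt a x) -[in RHS](coact_counit (ca_comodule A) a).
rewrite smelt_suml; apply: eq_bigr => r _.
by rewrite mul1r dact_unit -dual_scalerAl mul1r kmod_scaleE smeltZ.
Qed.

Fact smash_mul1r : right_id smash_one smash_mul.
Proof.
elim/smash_ind=> [a x||s t IHs IHt]; rewrite ?smash_mul0l ?smash_mulDl ?IHs ?IHt //.
rewrite smash_mul_elt ca_coact1 (sw_tens (core_bal _ _ _)).
by rewrite mulr1 dact1 mulr1.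
Qed.

HB.instance Definition _ := GRing.Zmodule_isPzRing.Build smash
  smash_mulA smash_mul1l smash_mul1r smash_mulDl smash_mulDr.

Lemma smashM a x b y : smelt a x * smelt b y =
  \sum_(r <- sw (ca_coact A (b : kmod A))) smelt (a * r.1) (dact x r.2 * y).
Proof. exact: smash_mul_elt. Qed.

Lemma smashMl a b y : smelt a 1 * smelt b y = smelt (a * b) y.
Proof.
rewrite smashM -[in RHS](coact_counit (ca_comodule A) b) mulr_sumr smelt_suml.
apply: eq_bigr => r _.
by rewrite dact_unit -dual_scalerAl mul1r kmod_scaleE kscalCA smeltZ.
Qed.

Lemma smashMr a x y : smelt a x * smelt 1 y = smelt a (x * y).
Proof.
by rewrite smashM ca_coact1 (sw_tens (core_bal _ _ _)) mulr1 dact1.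
Qed.

Definition smash_alg (a : A) : smash := smelt a 1.
Definition smash_dual (x : dual C) : smash := smelt 1 x.

Fact smash_alg_nmod : GRing.nmod_morphism smash_alg.
Proof. by split=> [|a b]; [exact: tens0l | exact: smeltDl]. Qed.
Fact smash_alg_monoid : GRing.monoid_morphism smash_alg.
Proof. by split=> // a b; rewrite /smash_alg smashMl. Qed.
HB.instance Definition _ :=
  GRing.isNmodMorphism.Build A smash smash_alg smash_alg_nmod.
HB.instance Definition _ :=
  GRing.isMonoidMorphism.Build A smash smash_alg smash_alg_monoid.

Fact smash_dual_nmod : GRing.nmod_morphism smash_dual.
Proof. by split=> [|x y]; [exact: tens0r | exact: smeltDr]. Qed.
Fact smash_dual_monoid : GRing.monoid_morphism smash_dual.
Proof. by split=> // x y; rewrite /smash_dual smashMr. Qed.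
HB.instance Definition _ :=
  GRing.isNmodMorphism.Build (dual C) smash smash_dual smash_dual_nmod.
HB.instance Definition _ :=
  GRing.isMonoidMorphism.Build (dual C) smash smash_dual smash_dual_monoid.

End Smash.

Arguments smash_dual {K H} A C x.
Arguments smash_alg {K H} A C a.

Section Rational.
Variables (K : comPzRingType) (C : coalgebra K).

(* K acts on a left module over dual C through k |-> k eps. *)
Definition is_rational (N : lmodType (dual C)) (m : N) : Prop :=
  exists s : seq (C * rscalars (dual_scal C) N), forall x : dual C,
    x *: m = \sum_(p <- s) x p.1 *: p.2.

Definition rat_pred (N : lmodType (dual C)) : {pred N} :=
  fun m => `[< is_rational m >].

Fact rat_submod_closed (N : lmodType (dual C)) :
  GRing.subsemimod_closed (@rat_pred N).
Proof.
split; first split.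
- apply/asboolP; exists [::] => x; by rewrite big_nil scaler0.
- move=> m n /asboolP[s sE] /asboolP[t tE]; apply/asboolP; exists (s ++ t) => x.
  by rewrite big_cat scalerDr sE tE.
- move=> y m /asboolP[s sE]; apply/asboolP.
  exists (flatten [seq [seq (q.1, y q.2 *: p.2) | q <- sw (comul C p.1)] | p <- s]).
  move=> x; rewrite scalerA sE big_flatten big_map; apply: eq_bigr => p _.
  rewrite big_map dualM scaler_suml; apply: eq_bigr => q _.
  by rewrite scalerA.
Qed.

HB.instance Definition _ (N : lmodType (dual C)) :=
  GRing.isSubSemiModClosed.Build (dual C) N (@rat_pred N) (@rat_submod_closed N).

Definition rat (N : lmodType (dual C)) : Type := {m : N | @rat_pred N m}.

HB.instance Definition _ N := SubType.on (rat N).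
HB.instance Definition _ N := Choice.on (rat N).
HB.instance Definition _ N := [SubChoice_isSubLmodule of rat N by <:].

Lemma ratP (N : lmodType (dual C)) (m : rat N) : is_rational (val m).
Proof. exact/asboolP/(valP m). Qed.

Section RatMap.
Variables (M N : lmodType (dual C)) (f : {linear M -> N}).

Fact rat_map_subproof (m : rat M) : rat_pred (f (val m)).
Proof.
have [s sE] := ratP m; apply/asboolP; exists [seq (p.1, f p.2) | p <- s] => x.
rewrite -linearZ sE linear_sum big_map; apply: eq_bigr => p _.
exact: (linearZZ f (dual_scal C (x p.1)) p.2).
Qed.

Definition rat_map_fun (m : rat M) : rat N := Sub (f (val m)) (rat_map_subproof m).

Fact rat_map_linear : linear rat_map_fun.
Proof. by move=> x m n; apply: val_inj; rewrite /= linearP. Qed.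

HB.instance Definition _ :=
  GRing.isLinear.Build (dual C) (rat M) (rat N) *:%R rat_map_fun rat_map_linear.

Definition rat_map : {linear rat M -> rat N} := rat_map_fun.

End RatMap.

Definition rat_exact : Prop :=
  forall (L M N : lmodType (dual C)) (f : {linear L -> M}) (g : {linear M -> N}),
    short_exact f g -> short_exact (rat_map f) (rat_map g).

Definition local_units (U : set (dual C)) : Prop :=
  [/\ forall e, U e -> is_rational (e : (dual C)^o),
      forall e, U e -> e * e = e,
      forall e e', U e -> U e' -> e * e' = e' * e &
      forall x, is_rational (x : (dual C)^o) ->
        exists e, [/\ U e, x * e = x & e * x = x]].

End Rational.

Section DoiKoppinen.
Variables (K : comPzRingType) (H : hopf_algebra K).
Variables (A : comodule_algebra H) (C : module_coalgebra H).

Record dk_module := DKModule {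
  dk_mod :> lmodType A;
  dk_coact : {linear kres dk_mod -> kres dk_mod \tens C};
  dk_comodule : is_comodule dk_coact;
  dk_compat : forall (a : A) (m : dk_mod), dk_coact (a *: m) =
    \sum_(p <- sw (ca_coact A a)) \sum_(q <- sw (dk_coact m))
      ((p.1 : A) *: (q.1 : dk_mod)) \ten[kres dk_mod, C] hact p.2 q.2 }.

Definition colinear (M N : dk_module) (f : M -> N) : Prop :=
  forall m, dk_coact N (f m) = tmap (M := kres M) (M' := kres N) f id (dk_coact M m).

Record dk_hom (M N : dk_module) := DKHom {
  dk_lin :> {linear M -> N};
  dk_colinear : colinear dk_lin }.

(* Monomorphism, injective object and essential monomorphism are meant in the
   category of Doi-Koppinen modules. *)
Definition dk_mono (M N : dk_module) (f : M -> N) : Prop :=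
  forall (L : dk_module) (g h : dk_hom L M), f \o g =1 f \o h -> g =1 h.

Definition dk_injective (E : dk_module) : Prop :=
  forall (U V : dk_module) (i : dk_hom U V) (f : dk_hom U E),
    dk_mono i -> exists g : dk_hom V E, g \o i =1 f.

Definition dk_essential (M E : dk_module) (i : dk_hom M E) : Prop :=
  forall (N : dk_module) (g : dk_hom E N), dk_mono (g \o i) -> dk_mono g.

Definition dk_injective_hull (M E : dk_module) (i : dk_hom M E) : Prop :=
  [/\ dk_injective E, dk_mono i & dk_essential i].

Section SmashModule.
Variable M : dk_module.

(* M as a left module over the smash product. *)
Definition dk_smash : Type := M.
HB.instance Definition _ := GRing.Zmodule.copy dk_smash M.

Definition dk_scale (s : smash A C) (m : dk_smash) : dk_smash :=
  \sum_(p <- sw s) \sum_(q <- sw (dk_coact M m))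
    (p.1 : A) *: (p.2 q.2 *: q.1 : M).

Lemma kres_scaleE k (m : kres M) : k *: m = kscal A k *: (m : M) :> M.
Proof. by []. Qed.

Lemma kscal_comm (k : K) (a : A) (m : M) :
  a *: (kscal A k *: m) = kscal A k *: (a *: m).
Proof. by rewrite !scalerA kscalC. Qed.

Fact dk_bal (a : A) (x : dual C) :
  balanced (fun (m : kres M) (c : C) => a *: (x c *: m : M)).
Proof.
split=> [c m m'|m c c'|k m c] /=.
- by rewrite scalerDr; apply: scalerDr.
- by rewrite dappDr scalerDl; apply: scalerDr.
- by rewrite dappZr mulrC; congr (_ *: _); apply: (scalerA (x c) k m).
Qed.

Fact dk_scale_bal (m : M) : balanced (fun (a : kmod A) (x : dual C) =>
  \sum_(q <- sw (dk_coact M m)) (a : A) *: (x q.2 *: q.1 : M)).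
Proof.
split=> [x a a'|a x x'|k a x]; rewrite -?big_split; apply: eq_bigr => q _ /=.
- exact: scalerDl.
- by rewrite dappDl scalerDl; apply: scalerDr.
- rewrite kmod_scaleE -scalerA -kscal_comm dappZl.
  by rewrite -[in RHS]scalerA.
Qed.

Lemma dk_scale_elt a x (m : M) : dk_scale (smelt a x) m =
  \sum_(q <- sw (dk_coact M m)) a *: (x q.2 *: q.1 : M).
Proof. exact: (sw_tens (dk_scale_bal m)). Qed.

Fact dk_scaleDl m : {morph dk_scale^~ m : s t / s + t}.
Proof. by move=> s t; apply: (swD (dk_scale_bal m)). Qed.

Fact dk_scaleDr : right_distributive dk_scale +%R.
Proof.
move=> s m n; rewrite /dk_scale -big_split; apply: eq_bigr => p _ /=.
rewrite -(swD (dk_bal p.1 p.2)); congr (\sum_(q <- sw _) _).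
exact: (linearD (dk_coact M)).
Qed.

Lemma dk_scale0l m : dk_scale 0 m = 0.
Proof. by apply: (addrI (dk_scale 0 m)); rewrite -dk_scaleDl !addr0. Qed.
Lemma dk_scale0r s : dk_scale s 0 = 0.
Proof. by apply: (addrI (dk_scale s 0)); rewrite -dk_scaleDr !addr0. Qed.
Lemma dk_scale_suml I (r : seq I) (F : I -> smash A C) m :
  dk_scale (\sum_(i <- r) F i) m = \sum_(i <- r) dk_scale (F i) m.
Proof.
by elim: r => [|i r IHr]; rewrite ?big_nil ?dk_scale0l // !big_cons dk_scaleDl IHr.
Qed.

Fact dk_scale1 : left_id 1 dk_scale.
Proof.
move=> m; rewrite dk_scale_elt -[RHS](coact_counit (dk_comodule M) m).
by apply: eq_bigr => q _; rewrite scale1r.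
Qed.

Let act3 (a b : A) (x y : dual C) (h : H) (m : kres M) (c d : C) : M :=
  a *: (kscal A (x (hact h c)) *: (b *: (kscal A (y d) *: (m : M)))).

Fact act3_bal1 (a b : A) (x : dual C) (h : H) : balanced (fun (m : kres M) (c : C) =>
  a *: (kscal A (x (hact h c)) *: (b *: (m : M)))).
Proof.
split=> [c m m'|m c c'|k m c].
- by rewrite !scalerDr.
- by rewrite hactDr dappDr rmorphD scalerDl scalerDr.
- rewrite kres_scaleE hactZr dappZr [k * _]mulrC rmorphM -scalerA.
  by rewrite [b *: (kscal A k *: _)]kscal_comm.
Qed.

Fact act3_bal2 (a b : A) (x y : dual C) (h : H) (d : C) : balanced (fun m c => act3 a b x y h m c d).
Proof.
split=> [c m m'|m c c'|k m c]; rewrite /act3.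
- by rewrite !scalerDr.
- by rewrite hactDr dappDr rmorphD scalerDl scalerDr.
- rewrite kres_scaleE hactZr dappZr [k * _]mulrC rmorphM -scalerA.
  rewrite [kscal A (y d) *: (kscal A k *: _)]kscal_comm.
  by rewrite [b *: (kscal A k *: _)]kscal_comm.
Qed.

Fact act3_bal3 (a b : A) (x y : dual C) (h : H) (m : M) : balanced (act3 a b x y h m).
Proof.
split=> [c d d'|c d d'|k c d]; rewrite /act3.
- by rewrite hactDr dappDr rmorphD scalerDl scalerDr.
- by rewrite dappDr rmorphD scalerDl !scalerDr.
- rewrite hactZr !dappZr [k * x _]mulrC !rmorphM -!scalerA.
  by rewrite [b *: (kscal A k *: _)]kscal_comm.
Qed.

Fact dk_scaleA s t m : dk_scale s (dk_scale t m) = dk_scale (s * t) m.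
Proof.
elim/smash_ind: s => [a x||s s' IHs IHs'].
- elim/smash_ind: t => [b y||t t' IHt IHt'].
  + rewrite smashM dk_scale_suml !dk_scale_elt.
    under [RHS]eq_bigr do rewrite dk_scale_elt.
    rewrite linear_sum (sw_sum (dk_bal _ _)).
    transitivity (\sum_(q <- sw (dk_coact M m)) \sum_(r <- sw (ca_coact A b))
       \sum_(u <- sw (dk_coact M q.1)) act3 a r.1 x y r.2 u.1 u.2 q.2).
      apply: eq_bigr => q _; rewrite dk_compat (sw_sum (dk_bal _ _)).
      apply: eq_bigr => r _; rewrite (sw_sum (dk_bal _ _)).
      rewrite linearZ.
      rewrite -(swZ (act3_bal1 a r.1 x r.2)).
      apply: eq_bigr => u _; exact: (sw_tens (dk_bal _ _)).
    rewrite exchange_big; apply: eq_bigr => r _.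
    rewrite (coaction_trilinear (f := act3 a r.1 x y r.2) _ (dk_comodule M)).
    * apply: eq_bigr => q _; rewrite dualM kres_scaleE rmorph_sum scaler_suml scaler_sumr.
      apply: eq_bigr => w _; rewrite /act3 dactE rmorphM -!scalerA.
      by rewrite [(r.1 : A) *: (kscal A (x _) *: _)]kscal_comm.
    * exact: act3_bal3.
    * exact: act3_bal2.
  + by rewrite mulr0 !dk_scale0l dk_scale0r.
  + by rewrite mulrDr !dk_scaleDl dk_scaleDr IHt IHt'.
- by rewrite mul0r !dk_scale0l.
- by rewrite mulrDl !dk_scaleDl IHs IHs'.
Qed.

HB.instance Definition _ := GRing.Zmodule_isLmodule.Build (smash A C) dk_smash
  dk_scaleA dk_scale1 dk_scaleDr dk_scaleDl.

End SmashModule.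

End DoiKoppinen.

Section RationalIdeal.
Variables (K : comPzRingType) (H : hopf_algebra K).
Variables (A : comodule_algebra H) (C : module_coalgebra H).

Notation ratC := (rat (dual C)^o).
Notation kratC := (rscalars (dual_scal C) ratC).

Lemma kdualE (k : K) (x : rscalars (dual_scal C) (dual C)^o) :
  k *: x = k *: (x : dual C) :> dual C.
Proof. exact: dual_scalE. Qed.

Lemma rational_mulr (x y : dual C) :
  is_rational (x : (dual C)^o) -> is_rational (x * y : (dual C)^o).
Proof.
case=> s sE; exists [seq (p.1, (p.2 : dual C) * y) | p <- s] => z.
have -> : z *: (x * y : (dual C)^o) = (z *: (x : (dual C)^o) : dual C) * y.
  exact: mulrA.
rewrite sE big_map mulr_suml; apply: eq_bigr => p _ /=.
by rewrite !kdualE dual_scalerAl.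
Qed.

Lemma rational_dact (x : dual C) (h : H) :
  is_rational (x : (dual C)^o) -> is_rational (dact x h : (dual C)^o).
Proof.
case=> s sE.
exists (flatten [seq [seq (hact (antipode H p.1 : H) q.1, dact q.2 p.2) | q <- s]
                | p <- sw (hopf_comul H h)]) => y.
rewrite big_flatten big_map.
transitivity (\sum_(p <- sw (hopf_comul H h)) dact (dact y (antipode H p.1) * x) p.2);
  last first.
  apply: eq_bigr => p _; rewrite big_map.
  rewrite -[_ * x]/((dact y (antipode H p.1 : H)) *: (x : (dual C)^o)) sE dact_suml.
  by apply: eq_bigr => q _; rewrite !kdualE dactZl dactE.
pose f (g1 g2 g3 : hopf_coalg H) : dual C :=
  dact y ((antipode H g1 : H) * g2) * dact x g3.
have antiZ k (g : hopf_coalg H) : antipode H (k *: g) = kscal H k * antipode H g :> H.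
  exact: (linearZZ (antipode H)).
transitivity (\sum_(p <- sw (hopf_comul H h))
    \sum_(q <- sw (hopf_comul H p.2)) f p.1 q.1 q.2); last first.
  apply: eq_bigr => p _; rewrite dactM; apply: eq_bigr => q _.
  by rewrite /f dactA.
rewrite -(comul_trilinear (C := hopf_coalg H) (f := f)).
- rewrite -[h in LHS](counitl (coalgP (hopf_coalg H)) h) dact_sumr.
  rewrite scaler_sumr; apply: eq_bigr => p _.
  rewrite /f -mulr_suml -dact_sumr antipodel -[kscal H _]mulr1 dactZr dact1.
  by rewrite hopf_scaleE dactZr -dual_scalerAl; apply/esym/dual_scalerAr.
- move=> g1; split=> [g3 g g'|g2 g g'|k g2 g3]; rewrite /f.
  + by rewrite mulrDr dactDr mulrDl.
  + by rewrite dactDr mulrDr.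
  + by rewrite !hopf_scaleE kscalCA !dactZr -dual_scalerAl -dual_scalerAr.
- move=> g3; split=> [g2 g g'|g1 g g'|k g1 g2]; rewrite /f.
  + by rewrite linearD mulrDl dactDr mulrDl.
  + by rewrite mulrDr dactDr mulrDl.
  + by rewrite antiZ hopf_scaleE kscalCA mulrA.
Qed.

(* The canonical map from A (x) Rat into A # C^*; its image is the ideal a. *)
Definition ideal_incl (t : kmod A \tens kratC) : smash A C :=
  \sum_(p <- sw t) smelt p.1 (val (p.2 : ratC)).

Fact ideal_incl_bal :
  balanced (fun (a : kmod A) (x : kratC) => smelt (C := C) a (val (x : ratC))).
Proof.
split=> [x a a'|a x x'|k a x].
- exact: smeltDl.
- by rewrite -smeltDr.
- by rewrite kmod_scaleE smeltZ; congr smelt; rewrite -dual_scalE.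
Qed.

Definition ideal_pred : {pred (smash A C)^o} :=
  fun s => `[< exists t, s = ideal_incl t >].

Fact ideal_pred0 : ideal_pred 0.
Proof. by apply/asboolP; exists 0; rewrite /ideal_incl (sw0 ideal_incl_bal). Qed.

Fact ideal_predD s t : ideal_pred s -> ideal_pred t -> ideal_pred (s + t).
Proof.
move=> /asboolP[u ->] /asboolP[v ->]; apply/asboolP; exists (u + v).
by rewrite /ideal_incl (swD ideal_incl_bal).
Qed.

Lemma ideal_pred_sum I (r : seq I) (F : I -> smash A C) :
  (forall i, ideal_pred (F i)) -> ideal_pred (\sum_(i <- r) F i).
Proof.
by move=> FI; elim/big_ind: _ => //; [exact: ideal_pred0 | exact: ideal_predD].
Qed.

Lemma ideal_pred_elt (a : A) (x : dual C) :
  is_rational (x : (dual C)^o) -> ideal_pred (smelt a x).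
Proof.
move=> xR; have xP : rat_pred (x : (dual C)^o) by apply/asboolP.
apply/asboolP; exists (tens (M := kmod A) (N := kratC) a (Sub x xP : ratC)).
by rewrite /ideal_incl (sw_tens ideal_incl_bal).
Qed.

Lemma rational_mull (y x : dual C) :
  is_rational (x : (dual C)^o) -> is_rational (y * x : (dual C)^o).
Proof.
move=> xR; apply/asboolP.
by apply: (rat_submod_closed (dual C)^o).2; apply/asboolP.
Qed.

Lemma ideal_pred_mull (s t : smash A C) : ideal_pred t -> ideal_pred (s * t).
Proof.
move=> /asboolP[u ->]; rewrite /ideal_incl mulr_sumr; apply: ideal_pred_sum => p.
elim/smash_ind: s => [b y||s s' IHs IHs'].
- rewrite smashM; apply: ideal_pred_sum => r; apply: ideal_pred_elt.
  exact/rational_mull/ratP.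
- by rewrite mul0r; apply: ideal_pred0.
- by rewrite mulrDl; apply: ideal_predD.
Qed.

Lemma ideal_pred_mulr (s t : smash A C) : ideal_pred s -> ideal_pred (s * t).
Proof.
move=> /asboolP[u ->]; rewrite /ideal_incl mulr_suml; apply: ideal_pred_sum => p.
elim/smash_ind: t => [b y||t t' IHt IHt'].
- rewrite smashM; apply: ideal_pred_sum => r; apply: ideal_pred_elt.
  exact/rational_mulr/rational_dact/ratP.
- by rewrite mulr0; apply: ideal_pred0.
- by rewrite mulrDr; apply: ideal_predD.
Qed.

Fact ideal_submod_closed : GRing.subsemimod_closed ideal_pred.
Proof.
split; first by split; [exact: ideal_pred0 | exact: ideal_predD].
by move=> s t; apply: ideal_pred_mull.
Qed.

HB.instance Definition _ := GRing.isSubSemiModClosed.Build (smash A C)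
  (smash A C)^o ideal_pred ideal_submod_closed.

Definition rat_ideal : Type := {s : (smash A C)^o | ideal_pred s}.

HB.instance Definition _ := SubType.on rat_ideal.
HB.instance Definition _ := Choice.on rat_ideal.
HB.instance Definition _ := [SubChoice_isSubLmodule of rat_ideal by <:].

(* Right multiplication by s on the two-sided ideal. *)
Definition ideal_mulr (s : smash A C) (x : rat_ideal) : rat_ideal :=
  Sub (val x * s : smash A C) (ideal_pred_mulr s (valP x)).

Fact ideal_mulr_linear s : linear (ideal_mulr s).
Proof.
move=> t x y; apply: val_inj.
by rewrite /= mulrDl; congr (_ + _); apply/esym/mulrA.
Qed.

HB.instance Definition _ s := GRing.isLinear.Build (smash A C) rat_ideal rat_ideal *:%R
  (ideal_mulr s) (ideal_mulr_linear s).

Definition ideal_elt (x : ratC) : rat_ideal :=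
  Sub (smelt 1 (val x)) (ideal_pred_elt 1 (ratP x)).

Section Hom.
Variable N : lmodType (smash A C).

Definition hom_ideal : Type := {linear rat_ideal -> N}.
HB.instance Definition _ := GRing.Zmodule.copy hom_ideal {linear rat_ideal -> N}.

(* (s f)(x) = f (x s) *)
Definition hom_ideal_scale (s : smash A C) (f : hom_ideal) : hom_ideal :=
  ((f : {linear rat_ideal -> N}) \o ideal_mulr s : {linear rat_ideal -> N}).

Fact hom_ideal_scaleA s t f :
  hom_ideal_scale s (hom_ideal_scale t f) = hom_ideal_scale (s * t) f.
Proof.
apply: linear_ext => x /=; congr (GRing.Linear.sort f _).
by apply: val_inj; rewrite /= mulrA.
Qed.

Fact hom_ideal_scale1 : left_id 1 hom_ideal_scale.
Proof.
move=> f; apply: linear_ext => x /=; congr (GRing.Linear.sort f _).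
by apply: val_inj; rewrite /= mulr1.
Qed.

Fact hom_ideal_scaleDr : right_distributive hom_ideal_scale +%R.
Proof. by move=> s f g; apply: linear_ext. Qed.

Fact hom_ideal_scaleDl f : {morph hom_ideal_scale^~ f : s t / s + t}.
Proof.
move=> s t; apply: linear_ext => x.
rewrite /=; transitivity (GRing.Linear.sort f (ideal_mulr s x + ideal_mulr t x)).
  by congr (GRing.Linear.sort f _); apply: val_inj; rewrite /= mulrDr.
exact: (linearD (f : {linear rat_ideal -> N})).
Qed.

HB.instance Definition _ := GRing.Zmodule_isLmodule.Build (smash A C) hom_ideal
  hom_ideal_scaleA hom_ideal_scale1 hom_ideal_scaleDr hom_ideal_scaleDl.

Definition hom_rat : Type := {linear ratC -> rscalars (smash_dual A C) N}.
HB.instance Definition _ :=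
  GRing.Zmodule.copy hom_rat {linear ratC -> rscalars (smash_dual A C) N}.

Definition hom_res_fun (f : hom_ideal) (x : ratC) : rscalars (smash_dual A C) N :=
  (f : {linear rat_ideal -> N}) (ideal_elt x).

Fact hom_res_linear f : linear (hom_res_fun f).
Proof.
move=> y x x'; rewrite /hom_res_fun.
rewrite -[RHS]/(smash_dual A C y *: (f : {linear rat_ideal -> N}) (ideal_elt x) +
  (f : {linear rat_ideal -> N}) (ideal_elt x')) -linearP.
by congr (GRing.Linear.sort f _); apply: val_inj; rewrite /= smeltDr -smashMr.
Qed.

HB.instance Definition _ f := GRing.isLinear.Build (dual C) ratC
  (rscalars (smash_dual A C) N) *:%R (hom_res_fun f) (hom_res_linear f).

Definition hom_res (f : hom_ideal) : hom_rat :=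
  (hom_res_fun f : {linear ratC -> rscalars (smash_dual A C) N}).

Lemma smeltE (a : A) (x : dual C) : smelt a x = smash_alg A C a * smash_dual A C x.
Proof. by rewrite smashMr mul1r. Qed.

Lemma ideal_sum (x : rat_ideal) : exists s : seq (A * ratC),
  x = \sum_(p <- s) smash_alg A C p.1 *: ideal_elt p.2.
Proof.
have /asboolP[t tE] := valP x; exists (sw t); apply: val_inj.
by rewrite linear_sum tE; apply: eq_bigr => p _ /=; apply: smeltE.
Qed.

Fact hom_res_inj : injective hom_res.
Proof.
move=> f g fg; apply: linear_ext => x.
have [s ->] := ideal_sum x; rewrite !linear_sum; apply: eq_bigr => p _.
rewrite !linearZ; congr (_ *: _).
exact: (congr1 (fun h : hom_rat =>
  (h : {linear ratC -> rscalars (smash_dual A C) N}) p.2) fg).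
Qed.

Section Extension.
Variable g : {linear ratC -> rscalars (smash_dual A C) N}.
Hypothesis flatA : flat (kmod A).

Definition kval (x : kratC) : dual C := val (x : ratC).
Fact kval_linear : linear kval.
Proof. by move=> k x y; rewrite -dual_scalE. Qed.
HB.instance Definition _ :=
  GRing.isLinear.Build K kratC (dual C) *:%R kval kval_linear.

Fact ideal_incl_inj : injective ideal_incl.
Proof. by apply: (flatA (f := kval)) => x y; apply: (@val_inj _ _ ratC). Qed.

Let ext_val (t : kmod A \tens kratC) : N :=
  \sum_(p <- sw t) smash_alg A C p.1 *: (g p.2 : N).

Fact ext_bal : balanced (fun (a : kmod A) (x : kratC) =>
  smash_alg A C a *: (g (x : ratC) : N)).
Proof.
split=> [x a a'|a x x'|k a x].
- by rewrite raddfD scalerDl.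
- by rewrite (linearD g); apply: scalerDr.
- rewrite -[k *: x]/(dual_scal C k *: (x : ratC)) linearZ.
  rewrite -[g _ in RHS]/(g _ : N).
  rewrite -[X in _ = _ *: X]/(smash_dual A C (dual_scal C k) *: (g (x : ratC) : N)).
  rewrite scalerA -smeltE kmod_scaleE; congr (_ *: _).
  by rewrite /smash_alg smeltZ.
Qed.

Lemma ext_valM (s : smash A C) t : exists u,
  ideal_incl u = s * ideal_incl t /\ ext_val u = s *: ext_val t.
Proof.
elim/tens_ind: t => [a x||t t' [u [uI uE]] [u' [uI' uE']]].
- elim/smash_ind: s => [b y||s s' [u [uI uE]] [u' [uI' uE']]].
  + exists (\sum_(r <- sw (ca_coact A a))
      (b * (r.1 : A)) \ten[kmod A, kratC] (dact y (r.2 : H) *: (x : ratC))).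
    rewrite /ideal_incl /ext_val (sw_tens ideal_incl_bal) (sw_tens ext_bal).
    rewrite (sw_sum ideal_incl_bal) (sw_sum ext_bal) smashM; split.
      by apply: eq_bigr => r _; rewrite (sw_tens ideal_incl_bal).
    rewrite scalerA smashM scaler_suml; apply: eq_bigr => r _.
    rewrite (sw_tens ext_bal) linearZ mulr1 smeltE -scalerA.
    by [].
  + exists 0; rewrite /ideal_incl /ext_val (sw0 ideal_incl_bal) (sw0 ext_bal).
    by rewrite mul0r scale0r.
  + exists (u + u'); rewrite {1}/ideal_incl {1}/ext_val.
    rewrite (swD ideal_incl_bal) (swD ext_bal).
    by rewrite -!/(ideal_incl _) -!/(ext_val _) uI uI' uE uE' mulrDl scalerDl.
- exists 0; rewrite /ideal_incl /ext_val (sw0 ideal_incl_bal) (sw0 ext_bal).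
  by rewrite mulr0 scaler0.
- exists (u + u'); rewrite {1 2}/ideal_incl {1 2}/ext_val.
  rewrite !(swD ideal_incl_bal) !(swD ext_bal).
  by rewrite -!/(ideal_incl _) -!/(ext_val _) uI uI' uE uE' mulrDr scalerDr.
Qed.

Lemma ideal_repr (x : rat_ideal) : exists t, val x = ideal_incl t.
Proof. exact/asboolP/(valP x). Qed.

Definition ext_fun (x : rat_ideal) : N := ext_val (projT1 (cid (ideal_repr x))).

Lemma ext_funE (x : rat_ideal) t : val x = ideal_incl t -> ext_fun x = ext_val t.
Proof.
rewrite /ext_fun; case: cid => u /= -> ut; congr (ext_val _).
exact: ideal_incl_inj.
Qed.

Fact ext_fun_linear : linear ext_fun.
Proof.
move=> s x y; have [t tE] := ideal_repr x; have [t' tE'] := ideal_repr y.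
have [u [uI uE]] := ext_valM s t.
rewrite (ext_funE tE) (ext_funE tE') -uE.
rewrite (@ext_funE _ (u + t')); first exact: (swD ext_bal).
by rewrite /= {1}/ideal_incl (swD ideal_incl_bal) -!/(ideal_incl _) uI tE tE'.
Qed.

HB.instance Definition _ := GRing.isLinear.Build (smash A C) rat_ideal N *:%R
  ext_fun ext_fun_linear.

Definition ext_hom : hom_ideal := (ext_fun : {linear rat_ideal -> N}).

Lemma ext_homK : hom_res ext_hom = g :> hom_rat.
Proof.
apply: linear_ext => x; rewrite /= /hom_res_fun /=.
have e : val (ideal_elt x) = ideal_incl (1 \ten[kmod A, kratC] x).
  by rewrite /ideal_incl (sw_tens ideal_incl_bal).
rewrite (ext_funE e) /ext_val (sw_tens ext_bal).
exact: scale1r.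
Qed.

End Extension.

Lemma hom_res_bij : flat (kmod A) -> bijective hom_res.
Proof.
move=> flatA; exists (fun g : hom_rat => ext_hom g flatA) => [f|g].
  by apply: hom_res_inj; apply: ext_homK.
exact: ext_homK.
Qed.

End Hom.
End RationalIdeal.

Section Corollary.
Variables (K : comPzRingType) (H : hopf_algebra K).
Variables (A : comodule_algebra H) (C : module_coalgebra H).
Hypothesis flatA : flat (kmod A).

Section Transfer.
Variable N : lmodType (smash A C).

Lemma hom_resK : cancel (@hom_res K H A C N) (fun g => ext_hom g flatA).
Proof. by move=> f; apply: hom_res_inj; apply: ext_homK. Qed.

(* hom_rat N with the A # C^*-module structure carried over from hom_ideal N along
   the bijection hom_res (see hom_res_bij, rat_hom_scaleE); bijectivity needs A
   flat, so the type records a proof of it. *)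
Definition rat_hom (fA : flat (kmod A)) : Type := hom_rat N.
HB.instance Definition _ := GRing.Zmodule.copy (rat_hom flatA) (hom_rat N).

Definition rat_hom_scale (s : smash A C) (g : rat_hom flatA) : rat_hom flatA :=
  hom_res (s *: ext_hom g flatA).

Lemma hom_resD : {morph @hom_res K H A C N : f g / f + g}.
Proof. by move=> f g; apply: linear_ext. Qed.

Lemma ext_homD (g h : rat_hom flatA) :
  ext_hom (g + h) flatA = ext_hom g flatA + ext_hom h flatA :> hom_ideal N.
Proof. by apply: hom_res_inj; rewrite hom_resD !ext_homK. Qed.

Fact rat_hom_scaleA s t g :
  rat_hom_scale s (rat_hom_scale t g) = rat_hom_scale (s * t) g.
Proof. by rewrite /rat_hom_scale hom_resK scalerA. Qed.

Fact rat_hom_scale1 : left_id 1 rat_hom_scale.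
Proof. by move=> g; rewrite /rat_hom_scale scale1r; apply: ext_homK. Qed.

Fact rat_hom_scaleDr : right_distributive rat_hom_scale +%R.
Proof. by move=> s g h; rewrite /rat_hom_scale ext_homD scalerDr; apply: hom_resD. Qed.

Fact rat_hom_scaleDl g : {morph rat_hom_scale^~ g : s t / s + t}.
Proof. by move=> s t; rewrite /rat_hom_scale scalerDl; apply: hom_resD. Qed.

HB.instance Definition _ :=
  GRing.Zmodule_isLmodule.Build (smash A C) (rat_hom flatA)
    rat_hom_scaleA rat_hom_scale1 rat_hom_scaleDr rat_hom_scaleDl.

Lemma rat_hom_scaleE (s : smash A C) (f : hom_ideal N) :
  s *: (hom_res f : rat_hom flatA) = hom_res (s *: f).
Proof. by rewrite -[f in RHS]hom_resK. Qed.

End Transfer.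

Section Zeta.
Variables (M E : dk_module A C) (i : dk_hom M E).

Definition zeta_fun (m : M) (x : rat (dual C)^o) :
    rscalars (smash_dual A C) (dk_smash E) :=
  (val x : dual C) *: (i m : rscalars (smash_dual A C) (dk_smash E)).

Fact zeta_linear m : linear (zeta_fun m).
Proof. by move=> y x x'; rewrite /zeta_fun /= scalerDl -scalerA. Qed.

HB.instance Definition _ m :=
  GRing.isLinear.Build (dual C) (rat (dual C)^o)
    (rscalars (smash_dual A C) (dk_smash E)) *:%R (zeta_fun m) (zeta_linear m).

Definition zeta (m : dk_smash M) : rat_hom (dk_smash E) flatA :=
  (zeta_fun m :
     {linear rat (dual C)^o -> rscalars (smash_dual A C) (dk_smash E)}).

End Zeta.

(* The action of dual C on M is c^* m = \sum m_0 c^*(m_1). *)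
Definition finite_support (U : set (dual C)) (M : dk_module A C) : Prop :=
  exists F : seq (dual C), [/\ uniq F, forall e, e \in F -> U e &
    forall m : rscalars (smash_dual A C) (dk_smash M),
      (\sum_(e <- F) e) *: m = m].

End Corollary.

(* Main.v *)
Require Import Defs.
From HB Require Import structures.
From mathcomp Require Import all_boot all_algebra.
From mathcomp Require Import boolp classical_sets functions.
(* Lets [rat] denote the rational part again, not the rational numbers. *)
Import Defs.

Set Implicit Arguments.
Unset Strict Implicit.
Unset Printing Implicit Defensive.

Import GRing.Theory.
Local Open Scope ring_scope.

(* Put S = A # C^* and T = Rat(C^* ). Local projectivity of C identifies the
   Doi-Koppinen modules with the S-modules that are rational over C^*, and
   applying the exact functor Rat to C^* -> C^* m gives, for each rational m, some
   t in T with t m = m.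

   For E injective in the Doi-Koppinen category, an S-linear f : U -> Hom(T, E)
   and an inclusion of U in V, the assignment u |-> e whenever f(u)(x) = x e for
   all x in T extends to g : Rat(V) -> E, and v |-> (y |-> g(y v)), y in the
   ideal A (x) T, extends f. Essentiality of zeta comes from (t f)(x) = x f(t) for
   t in T, that is, t f = zeta(f(t)).

   Under finite support zeta is onto, so M is injective over S. If the antipode has
   an inverse s, then b # y |-> \sum y s(b_1) (x) b_0 identifies S (x)_A V with
   C^* (x) V, which is exact in V when C^* is flat, so that restriction of scalars
   from S to A preserves injectivity. *)

(** * Partial linear maps given by their graphs *)

Section Submodules.
Variables (R : pzRingType) (E : lmodType R) (X : set E).
Hypothesis sX : submodule X.

(** The proof of [submodule X] is a phantom argument: it keys the closure instance, from which the
    module structure of [submod] is inferred. *)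
Definition submod_pred (_ : submodule X) : {pred E} := fun x => `[< X x >].

Fact submod_closed : GRing.subsemimod_closed (submod_pred sX).
Proof.
case: sX => X0 XD XZ; split; first split.
- exact/asboolP.
- by move=> x y /asboolP Xx /asboolP Xy; apply/asboolP/XD.
- by move=> r x /asboolP Xx; apply/asboolP/XZ.
Qed.

HB.instance Definition _ := GRing.isSubSemiModClosed.Build R E
  (submod_pred sX) submod_closed.

Definition submod : Type := {x : E | submod_pred sX x}.

HB.instance Definition _ := SubType.on submod.
HB.instance Definition _ := Choice.on submod.
HB.instance Definition _ := [SubChoice_isSubLmodule of submod by <:].

Lemma submodP (x : submod) : X (val x).
Proof. exact/asboolP/(valP x). Qed.

Definition submod_elt x (Xx : X x) : submod :=
  Sub x (introT (asboolP (X x)) Xx : submod_pred sX x).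

Definition submod_val : {linear submod -> E} := val.

Lemma submod_val_inj : injective submod_val.
Proof. exact: val_inj. Qed.

End Submodules.

Definition linear_of (R : pzRingType) (U V : lmodType R) (f : U -> V)
    (fL : linear f) : {linear U -> V} :=
  HB.pack f (GRing.isLinear.Build R U V *:%R f fL).

Section Graphs.
Variables (R : pzRingType) (V E : lmodType R) (G : V -> E -> Prop).

(** Single-valuedness is asked only at 0; by linearity it propagates to every point
    ([graph_inj]). *)
Record linear_graph : Prop := LinearGraph {
  graph0 : G 0 0;
  graphD : forall v w e d, G v e -> G w d -> G (v + w) (e + d);
  graphZ : forall r v e, G v e -> G (r *: v) (r *: e);
  graph_fun : forall e, G 0 e -> e = 0 }.

Hypothesis gG : linear_graph.

Lemma graph_inj v e e' : G v e -> G v e' -> e = e'.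
Proof.
move=> Ge /(graphZ gG (-1)) Ge'; apply/subr0_eq/(graph_fun gG).
by rewrite -(subrr v) -!scaleN1r; apply: (graphD gG).
Qed.

Definition graph_dom : set V := [set v | exists e, G v e].

Lemma graph_dom_submodule : submodule graph_dom.
Proof.
split.
- by exists 0; apply: (graph0 gG).
- by move=> v w [e Ge] [d Gd]; exists (e + d); apply: (graphD gG).
- by move=> r v [e Ge]; exists (r *: e); apply: (graphZ gG).
Qed.

Lemma graph_linear : exists f : {linear submod graph_dom_submodule -> E},
  forall d, G (val d) (f d).
Proof.
pose f (d : submod graph_dom_submodule) := projT1 (cid (submodP d)).
have fE d : G (val d) (f d) by rewrite /f; case: cid.
have fL : linear f.
  move=> r d d'; apply: (graph_inj (fE _)); rewrite /=.
  exact: (graphD gG (graphZ gG r (fE d)) (fE d')).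
by exists (linear_of fL).
Qed.

(** Injectivity in the form used below: a partial map can be extended without first being named as a
    function on a submodule. *)
Lemma injective_graph : injective_module E ->
  exists g : {linear V -> E}, forall v e, G v e -> g v = e.
Proof.
move=> /(_ _ _ (submod_val graph_dom_submodule)) injE.
have [f fE] := graph_linear; have [g gE] := injE f val_inj.
exists g => v e Ge; have Dv : graph_dom v by exists e.
have := gE (submod_elt graph_dom_submodule Dv); rewrite /= => ->.
exact: (graph_inj (fE _)).
Qed.

End Graphs.

(** * Rational modules over the dual algebra *)

Section LocallyProjective.
Variables (K : comPzRingType) (C : coalgebra K).
Hypothesis lpC : locally_projective C.

Lemma dual_basis (F : seq C) : exists s : seq (C * dual C),
  forall c, c \in F -> c = \sum_(p <- s) p.2 c *: p.1.
Proof. exact: lpC. Qed.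

Section Evaluation.
Variable P : lmodType K.

Lemma dapp_balanced (x : dual C) : balanced (fun (m : P) (c : C) => x c *: m).
Proof.
split=> [c m m'|m c c'|k m c]; first exact: scalerDr.
  by rewrite dappDr scalerDl.
by rewrite dappZr scalerA mulrC.
Qed.

(** Only finitely many elements of [C] occur in [t] and [u]; a common dual basis for them recovers
    each tensor from its values on functionals. Identities in P (x) C can therefore be tested one
    functional at a time. *)
Lemma tens_dapp_inj (t u : P \tens C) :
  (forall x : dual C, \sum_(p <- sw t) x p.2 *: p.1 =
                      \sum_(p <- sw u) x p.2 *: p.1) -> t = u.
Proof.
move=> tu; have [s sE] := dual_basis (map snd (sw t) ++ map snd (sw u)).
have tE v : {subset map snd (sw v) <= map snd (sw t) ++ map snd (sw u)} ->
    v = \sum_(l <- s) (\sum_(p <- sw v) l.2 p.2 *: p.1) \ten l.1.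
  move=> vs; under eq_bigr do rewrite tens_suml.
  rewrite exchange_big -[LHS]swK big_seq [RHS]big_seq; apply: eq_bigr => p pv.
  rewrite {1}(sE p.2); last by apply/vs/map_f.
  by rewrite tens_sumr; apply: eq_bigr => l _; rewrite tensZr tensZl.
rewrite [t]tE => [|c ct]; last by rewrite mem_cat ct.
rewrite [u in RHS]tE => [|c cu]; last by rewrite mem_cat cu orbT.
by apply: eq_bigr => l _; rewrite tu.
Qed.

Let dapp2 (x y : dual C) (m : P) (c d : C) : P := (x c * y d) *: m.

Let dapp2_l x y m : balanced (dapp2 x y m).
Proof.
split=> [d c c'|c d d'|k c d]; rewrite /dapp2 ?dappDr.
- by rewrite mulrDl scalerDl.
- by rewrite mulrDr scalerDl.
- by rewrite !dappZr mulrCA mulrA.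
Qed.

Let dapp2_r x y d : balanced (fun m c => dapp2 x y m c d).
Proof.
split=> [c m m'|m c c'|k m c]; rewrite /dapp2; first exact: scalerDr.
  by rewrite dappDr mulrDl scalerDl.
by rewrite dappZr scalerA -[k * _ * _]mulrA [k * _]mulrC.
Qed.

Lemma tens_dapp2_inj (t u : P \tens (C \tens C)) :
  (forall x y : dual C,
     \sum_(p <- sw t) \sum_(q <- sw p.2) (x q.1 * y q.2) *: p.1 =
     \sum_(p <- sw u) \sum_(q <- sw p.2) (x q.1 * y q.2) *: p.1) -> t = u.
Proof.
(* [D v] collects the elements of [C] from both factors, since the dual basis is applied to each of
   them. *)
move=> tu; pose D (v : P \tens (C \tens C)) :=
  flatten [seq flatten [seq [:: q.1; q.2] | q <- sw p.2] | p <- sw v].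
have [s sE] := dual_basis (D t ++ D u).
have tE v : {subset D v <= D t ++ D u} ->
    v = \sum_(l <- s) \sum_(l' <- s)
      (\sum_(p <- sw v) \sum_(q <- sw p.2) (l.2 q.1 * l'.2 q.2) *: p.1) \ten
        (l.1 \ten l'.1).
  move=> vs; under eq_bigr => l _ do under eq_bigr => l' _ do
    (rewrite tens_suml; under eq_bigr => p _ do rewrite tens_suml).
  under eq_bigr => l _ do rewrite exchange_big.
  rewrite exchange_big -[LHS]swK big_seq [RHS]big_seq; apply: eq_bigr => p pv.
  under eq_bigr => l _ do rewrite exchange_big.
  rewrite exchange_big -{1}[p.2]swK tens_sumr big_seq [RHS]big_seq.
  apply: eq_bigr => q qp.
  have Dq c : c \in [:: q.1; q.2] -> c \in D t ++ D u.
    move=> cq; apply: vs; apply/flattenP.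
    exists (flatten [seq [:: q.1; q.2] | q <- sw p.2]).
      by apply/mapP; exists p.
    apply/flattenP; exists [:: q.1; q.2] => //.
    by apply/mapP; exists q.
  rewrite {1}(sE q.1) ?Dq ?mem_head // {1}(sE q.2) ?Dq ?in_cons ?eqxx ?orbT //.
  rewrite tens_suml tens_sumr; apply: eq_bigr => l _.
  rewrite !tens_sumr; apply: eq_bigr => l' _.
  by rewrite !(tensZl, tensZr) scalerA.
rewrite [t]tE => [|c ct]; last by rewrite mem_cat ct.
rewrite [u in RHS]tE => [|c cu]; last by rewrite mem_cat cu orbT.
by apply: eq_bigr => l _; apply: eq_bigr => l' _; rewrite tu.
Qed.

(* The two iterated sums in the coassociativity axiom are evaluated by
   [sw_trilinear]; this is the form in which they are compared. *)
Lemma tens3_ext I J I' J' (r : seq I) (s : I -> seq J) (r' : seq I')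
    (s' : I' -> seq J') (m : I -> J -> P) (c d : I -> J -> C)
    (m' : I' -> J' -> P) (c' d' : I' -> J' -> C) :
  (forall x y : dual C,
     \sum_(i <- r) \sum_(j <- s i) (x (c i j) * y (d i j)) *: m i j =
     \sum_(i <- r') \sum_(j <- s' i) (x (c' i j) * y (d' i j)) *: m' i j) ->
  \sum_(i <- r) \sum_(j <- s i) m i j \ten (c i j \ten d i j) =
  \sum_(i <- r') \sum_(j <- s' i) m' i j \ten (c' i j \ten d' i j).
Proof.
move=> e; apply: tens_dapp2_inj => x y.
by rewrite !(sw_trilinear (dapp2_l x y) (dapp2_r x y)); apply: e.
Qed.

End Evaluation.

(** Expanding the [c_i] of a rationality witness in a dual basis replaces the unknown [m_i] by
    elements of C^* m, which lie in every submodule containing [m]. *)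
Lemma rational_coords (N : lmodType (dual C)) (m : N) : is_rational m ->
  exists s : seq (C * dual C), forall x : dual C,
    x *: m = \sum_(p <- s) dual_scal C (x p.1) *: (p.2 *: m).
Proof.
case=> s sE; have [t tE] := dual_basis (map fst s).
exists t => x; rewrite sE.
transitivity (\sum_(p <- s) \sum_(l <- t)
    dual_scal C (x l.1) *: (dual_scal C (l.2 p.1) *: (p.2 : N))).
  rewrite big_seq [RHS]big_seq; apply: eq_bigr => p ps.
  rewrite {1}(tE p.1) ?map_f // dapp_sumr.
  rewrite scaler_suml; apply: eq_bigr => l _.
  by rewrite dappZr mulrC -scalerA.
rewrite exchange_big; apply: eq_bigr => l _.
by rewrite sE -scaler_sumr.
Qed.

Lemma rational_sub (N L : lmodType (dual C)) (f : {linear L -> N}) (m : L) :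
  injective f -> is_rational (f m) -> is_rational m.
Proof.
move=> f_inj /rational_coords[s sE].
exists [seq (p.1, p.2 *: m) | p <- s] => x; apply: f_inj.
rewrite [LHS]linearZ_LR.
rewrite sE big_map linear_sum; apply: eq_bigr => p _ /=.
by rewrite -linearZ; apply/esym/(linearZZ f (dual_scal C (x p.1))).
Qed.

Lemma rational_scale (N : lmodType (dual C)) (x : dual C) (m : N) :
  is_rational (x : (dual C)^o) -> is_rational (x *: m).
Proof.
case=> s sE; exists [seq (p.1, (p.2 : dual C) *: m) | p <- s] => y.
rewrite scalerA -[y * x]/(y *: (x : (dual C)^o)) sE big_map scaler_suml.
apply: eq_bigr => p _; apply/esym.
exact: (scalerA (dual_scal C (y p.1)) (p.2 : dual C) m).
Qed.

Hypothesis ratC : rat_exact C.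

(* Exactness is applied to the surjection C^* -> C^* m. *)
Lemma rational_unit (N : lmodType (dual C)) (m : N) : is_rational m ->
  exists2 t : dual C, is_rational (t : (dual C)^o) & t *: m = m.
Proof.
move=> mR; pose X : set N := fun n => exists x : dual C, x *: m = n.
have sX : submodule X.
  split; first by exists 0; rewrite scale0r.
    by move=> _ _ [x <-] [y <-]; exists (x + y); rewrite scalerDl.
  by move=> y _ [x <-]; exists (y * x); rewrite scalerA.
pose L : set (dual C)^o := fun x => (x : dual C) *: m = 0.
have sL : submodule L.
  split; first exact: scale0r.
    by move=> x y xL yL; rewrite /L /= scalerDl xL yL addr0.
  by move=> y x xL; rewrite /L /= -scalerA xL scaler0.
pose g0 (x : (dual C)^o) : submod sX :=
  submod_elt sX (ex_intro _ x erefl : X ((x : dual C) *: m)).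
have g0L : linear g0.
  by move=> y x x'; apply: val_inj; rewrite /= scalerDl scalerA.
have /ratC[_ _ surj] : short_exact (submod_val sL) (linear_of g0L).
  split=> [|x|n]; first exact: val_inj.
    split=> [/(congr1 val) /= xm|[y <-]].
      by exists (submod_elt sL xm).
    by apply: val_inj; apply: (submodP y).
  have [x xE] := submodP n; exists x; exact: val_inj.
have Xm : X m by exists 1; rewrite scale1r.
pose n := submod_elt sX Xm.
(* [m] is rational already inside C^* m, so exactness lifts it to a rational element of C^*. *)
have nR : rat_pred n.
  by apply/asboolP; apply: (rational_sub (@submod_val_inj _ _ _ sX)).
have [t /(congr1 val)/(congr1 val) /= tE] := surj (Sub n nR).
by exists (val t); [exact: ratP | exact: tE].
Qed.

End LocallyProjective.

Arguments dapp_balanced {K C P} x.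

(** * Doi-Koppinen modules as rational modules over the smash product *)

Section DoiKoppinenModules.
Variables (K : comPzRingType) (H : hopf_algebra K).
Variables (A : comodule_algebra H) (C : module_coalgebra H).
Hypothesis lpC : locally_projective C.

Local Notation dualres N := (rscalars (smash_dual A C) N).
Local Notation algres N := (rscalars (smash_alg A C) N).

Definition rational_module (N : lmodType (smash A C)) : Prop :=
  forall n : dualres N, is_rational n.

(** Ensures that the actions of [K] through [A] and through C^* coincide on every module over A #
    C^*. *)
Lemma smash_kscal k : smash_alg A C (kscal A k) = smash_dual A C (dual_scal C k).
Proof. by rewrite /smash_alg -[kscal A k]mulr1 smeltZ. Qed.

Lemma smash_dual_alg (x : dual C) (a : A) :
  smash_dual A C x * smash_alg A C a =
  \sum_(r <- sw (ca_coact A a)) smash_alg A C r.1 * smash_dual A C (dact x r.2).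
Proof.
rewrite smashM; apply: eq_bigr => r _.
by rewrite mul1r mulr1 smeltE.
Qed.

Section Realisation.
Variable N : lmodType (smash A C).
Hypothesis ratN : rational_module N.

Lemma coact_exists (n : N) : exists t : kres (algres N) \tens C,
  forall x : dual C, \sum_(p <- sw t) x p.2 *: p.1 = smash_dual A C x *: n.
Proof.
have [s sE] := ratN n.
exists (\sum_(p <- s) (p.2 : kres (algres N)) \ten p.1) => x.
rewrite (sw_sum (dapp_balanced x)) [RHS]sE; apply: eq_bigr => p _.
rewrite (sw_tens (dapp_balanced x)).
exact: (congr1 (fun s => s *: (p.2 : N)) (smash_kscal (x p.1))).
Qed.

(** The choice is immaterial: by [tens_dapp_inj] the tensor is determined by the action of C^*. *)
Definition rational_coact_fun (n : kres (algres N)) : kres (algres N) \tens C :=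
  projT1 (cid (coact_exists n)).

Lemma rational_coactE n (x : dual C) :
  \sum_(p <- sw (rational_coact_fun n)) x p.2 *: p.1 =
  smash_dual A C x *: (n : N) :> N.
Proof. by rewrite /rational_coact_fun; case: cid. Qed.

Fact rational_coact_linear : linear rational_coact_fun.
Proof.
move=> k m n; apply: (tens_dapp_inj lpC) => x.
rewrite (swD (dapp_balanced x)) (swZ (dapp_balanced x)).
rewrite [LHS]rational_coactE scalerDr; congr (_ + _); last first.
  exact/esym/rational_coactE.
under eq_bigr do rewrite /= scalerA [X in X *: _]mulrC -scalerA.
rewrite -scaler_sumr.
rewrite -[RHS]/(smash_alg A C (kscal A k) *:
  (\sum_(p <- sw (rational_coact_fun m)) x p.2 *: p.1 : N)).
rewrite rational_coactE -[k *: m]/(smash_alg A C (kscal A k) *: (m : N)).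
rewrite !scalerA smash_kscal -!rmorphM /=.
by rewrite dual_scalE dual_scalEr.
Qed.

Definition rational_coact :
    {linear kres (algres N) -> kres (algres N) \tens C} :=
  linear_of rational_coact_linear.

(** Tested on functionals, coassociativity is x(yn) = (xy)n and the counit law is 1n = n. *)
Fact rational_comodule : is_comodule rational_coact.
Proof.
split=> n; last first.
  by have := rational_coactE n 1; rewrite rmorph1 scale1r.
apply: (tens3_ext lpC) => x y.
transitivity (\sum_(p <- sw (rational_coact_fun n)) y p.2 *:
    (smash_dual A C x *: (p.1 : N) : kres (algres N))).
  apply: eq_bigr => p _; rewrite -rational_coactE scaler_sumr.
  by apply: eq_bigr => q _; rewrite scalerA mulrC.
transitivity (smash_dual A C x *: (smash_dual A C y *: (n : N))).
  rewrite -(rational_coactE n y) scaler_sumr; apply: eq_bigr => p _.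
  rewrite -[_ *: _ in LHS]/(smash_alg A C (kscal A (y p.2)) *:
    (smash_dual A C x *: (p.1 : N))).
  rewrite -[_ *: p.1]/(smash_alg A C (kscal A (y p.2)) *: (p.1 : N)).
  rewrite !scalerA smash_kscal -!rmorphM /=.
  by rewrite dual_scalE dual_scalEr.
rewrite scalerA -rmorphM -rational_coactE; apply: eq_bigr => p _.
by rewrite dualM scaler_suml.
Qed.

(** Tested on functionals, this is the commutation rule [smash_dual_alg]. *)
Fact rational_compat (a : A) (n : algres N) : rational_coact (a *: n) =
  \sum_(p <- sw (ca_coact A a)) \sum_(q <- sw (rational_coact n))
    ((p.1 : A) *: (q.1 : algres N)) \ten[kres (algres N), C] hact p.2 q.2.
Proof.
apply: (tens_dapp_inj lpC) => x; rewrite (sw_sum (dapp_balanced x)).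
rewrite [LHS]rational_coactE scalerA smash_dual_alg scaler_suml.
apply: eq_bigr => r _; rewrite (sw_sum (dapp_balanced x)).
rewrite -scalerA -rational_coactE scaler_sumr; apply: eq_bigr => q _.
rewrite (sw_tens (dapp_balanced x)).
rewrite -[RHS]/(smash_alg A C (kscal A (x (hact r.2 q.2))) *:
  (smash_alg A C r.1 *: (q.1 : N))).
rewrite scalerA -rmorphM /= kscalC rmorphM -scalerA.
by [].
Qed.

Definition rational_dk : dk_module A C :=
  DKModule rational_comodule rational_compat.

(** Products of elements of [A] and C^* span A # C^*, and each of the two acts as before; so passing
    to Doi-Koppinen modules and back loses nothing. *)
Lemma rational_dk_scale s (n : N) : s *: (n : dk_smash rational_dk) = s *: n :> N.
Proof.
elim/smash_ind: s => [a x||s t IHs IHt]; first last.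
- by rewrite !scalerDl IHs IHt.
- by rewrite !scale0r.
rewrite [LHS]dk_scale_elt -scaler_sumr smeltE -scalerA -rational_coactE.
by [].
Qed.

End Realisation.

Section Action.
Variable M : dk_module A C.

Lemma dk_alg_scale a (m : dk_smash M) : smash_alg A C a *: m = a *: (m : M) :> M.
Proof.
rewrite [LHS]dk_scale_elt -scaler_sumr; congr (_ *: _).
exact: (coact_counit (dk_comodule M) m).
Qed.

Lemma dk_dual_scale (x : dual C) (m : dk_smash M) :
  smash_dual A C x *: m = \sum_(q <- sw (dk_coact M m)) x q.2 *: q.1 :> kres M.
Proof. by rewrite [LHS]dk_scale_elt; apply: eq_bigr => q _; rewrite scale1r. Qed.

Lemma dk_rational : rational_module (dk_smash M).
Proof.
move=> m; exists [seq (q.2, q.1 : dk_smash M) | q <- sw (dk_coact M m)] => x.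
rewrite [LHS]dk_dual_scale big_map; apply: eq_bigr => q _ /=.
rewrite -[RHS]/(smash_dual A C (dual_scal C (x q.2)) *: (q.1 : dk_smash M)).
by rewrite -smash_kscal [RHS]dk_alg_scale.
Qed.

End Action.

Fact dk_hom_linear (M N : dk_module A C) (f : dk_hom M N) :
  linear (f : dk_smash M -> dk_smash N).
Proof.
move=> s m n; rewrite -[LHS]/(f ((s *: m : M) + (n : M))) linearD.
congr (_ + _); elim/smash_ind: s => [a x||s t IHs IHt].
- rewrite [RHS]dk_scale_elt [s in f s]dk_scale_elt linear_sum dk_colinear.
  rewrite (sw_sum (dk_bal N a x)); apply: eq_bigr => q _.
  rewrite (sw_tens (dk_bal N a x)) [LHS]linearZZ.
  exact: (congr1 (fun n : N => a *: n) (linearZZ f (kscal A (x q.2)) q.1)).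
- by rewrite !scale0r; apply: linear0.
- rewrite !scalerDl -IHs -IHt.
  exact: (linearD f (s *: m : M) (t *: m : M)).
Qed.

Definition dk_smash_map (M N : dk_module A C) (f : dk_hom M N) :
  {linear dk_smash M -> dk_smash N} := linear_of (dk_hom_linear f).

(** Colinearity may be tested on functionals, where it becomes C^*-linearity. *)
Lemma dk_hom_of (M N : dk_module A C) (g : {linear dk_smash M -> dk_smash N}) :
  exists h : dk_hom M N, forall m, h m = g m.
Proof.
have gL : linear (g : M -> N).
  move=> a m n; rewrite -dk_alg_scale -[RHS]/(_ + g n) -dk_alg_scale.
  exact: linearP.
pose h : {linear M -> N} := linear_of gL.
suffices hC : colinear h by exists (DKHom hC).
move=> m; apply: (tens_dapp_inj lpC) => x.
rewrite (sw_sum (dapp_balanced x)) -[LHS](dk_dual_scale x (g m)).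
rewrite -linearZ -[s in g s]/(dk_scale _ _ : M) [s in g s]dk_dual_scale.
rewrite [LHS](linear_sum h); apply: eq_bigr => q _.
rewrite (sw_tens (dapp_balanced x)); exact: (linearZZ h (kscal A (x q.2)) q.1).
Qed.

Lemma dk_hom_from (N : lmodType (smash A C)) (ratN : rational_module N)
    (M : dk_module A C) (g : {linear N -> dk_smash M}) :
  exists h : dk_hom (rational_dk ratN) M, forall n, h n = g n.
Proof.
have gL : linear (g : dk_smash (rational_dk ratN) -> dk_smash M).
  by move=> s m n; rewrite -linearP; congr (g (_ + _)); apply: (rational_dk_scale ratN).
exact: (dk_hom_of (linear_of gL)).
Qed.

Lemma dk_hom_between (N P : lmodType (smash A C)) (ratN : rational_module N)
    (ratP : rational_module P) (g : {linear N -> P}) :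
  exists h : dk_hom (rational_dk ratN) (rational_dk ratP), forall n, h n = g n.
Proof.
have gL : linear (g : N -> dk_smash (rational_dk ratP)).
  move=> s m n; rewrite linearP; congr (_ + _).
  exact: (esym (rational_dk_scale ratP s (g m))).
exact: (dk_hom_from ratN (linear_of gL)).
Qed.

Lemma rational_res_sub (N L : lmodType (smash A C)) (f : {linear L -> N}) (n : L) :
  injective f -> is_rational (f n : dualres N) -> is_rational (n : dualres L).
Proof.
move=> f_inj; have fL : linear (f : dualres L -> dualres N).
  by move=> x m m'; exact: (linearP f (smash_dual A C x) m m').
exact: (rational_sub (f := linear_of fL) lpC f_inj).
Qed.

Lemma rational_module_sub (N L : lmodType (smash A C)) (f : {linear L -> N}) :
  injective f -> rational_module N -> rational_module L.
Proof.
by move=> f_inj ratN n; apply: (rational_res_sub f_inj (ratN (f n))).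
Qed.

Lemma injective_dk_mono (M N : dk_module A C) (f : M -> N) :
  injective f -> dk_mono f.
Proof. by move=> f_inj L g h fgh x; apply/f_inj/fgh. Qed.

(** The kernel is rational, hence a Doi-Koppinen module; its inclusion and the zero map agree after
    composition with [f], so they are equal. *)
Lemma dk_mono_injective (M N : dk_module A C) (f : dk_hom M N) :
  dk_mono f -> injective f.
Proof.
move=> f_mono; pose X : set (dk_smash M) := fun m => f m = 0.
have sX : submodule X.
  split; first exact: linear0.
    by move=> m n Xm Xn; rewrite /X [LHS]linearD Xm Xn addr0.
  move=> s m Xm; rewrite /X -(scaler0 (dk_smash N) s).
  rewrite -[in RHS](Xm : f m = 0).
  exact: (linearZZ (dk_smash_map f) s m).
have ratX := rational_module_sub (@submod_val_inj _ _ _ sX) (@dk_rational M).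
have [g gE] := dk_hom_from ratX (submod_val sX).
have [h hE] := dk_hom_from ratX (\0 : {linear submod sX -> dk_smash M}).
have gh : g =1 h.
  apply: f_mono => n /=; rewrite gE hE [RHS]linear0.
  exact: (submodP n).
move=> m n fmn; apply/subr0_eq.
have Xd : X (m - n) by rewrite /X [LHS]linearB fmn subrr.
by have := gh (submod_elt sX Xd); rewrite gE hE.
Qed.

(** Counterpart of [injective_graph]: the domain of the graph, a submodule of a rational module, is
    itself an object of the Doi-Koppinen category. *)
Lemma dk_injective_graph (E : dk_module A C) (V : lmodType (smash A C))
    (G : V -> dk_smash E -> Prop) :
  dk_injective E -> rational_module V -> linear_graph G ->
  exists g : {linear V -> dk_smash E}, forall v e, G v e -> g v = e.
Proof.
move=> injE ratV gG; have [f fE] := graph_linear gG.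
have ratD := rational_module_sub
  (@submod_val_inj _ _ _ (graph_dom_submodule gG)) ratV.
have [i iE] := dk_hom_between ratD ratV (submod_val _).
have [f' f'E] := dk_hom_from ratD f.
have i_mono : dk_mono i.
  by apply: injective_dk_mono => d d'; rewrite !iE; apply: val_inj.
have [g gE] := injE _ _ i f' i_mono.
have gL : linear (g : V -> dk_smash E).
  move=> s m n; rewrite -[RHS](linearP (dk_smash_map g)) /=.
  by congr (g (_ + _)); apply: (esym (rational_dk_scale ratV s m)).
exists (linear_of gL) => v e Ge; have Dv : graph_dom G v by exists e.
have := gE (submod_elt (graph_dom_submodule gG) Dv).
rewrite /= iE f'E /= => ->.
exact: (graph_inj gG (fE _)).
Qed.

Lemma injective_dk_injective (E : dk_module A C) :
  injective_module (dk_smash E) -> dk_injective E.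
Proof.
move=> injE U V i f /dk_mono_injective i_inj.
have [g gE] := injE _ _ (dk_smash_map i) (dk_smash_map f) i_inj.
have [h hE] := dk_hom_of g.
by exists h => u /=; rewrite hE; apply: gE.
Qed.

End DoiKoppinenModules.

(** * The rational part of a module over the smash product *)

Section RationalSubmodule.
Variables (K : comPzRingType) (H : hopf_algebra K).
Variables (A : comodule_algebra H) (C : module_coalgebra H).
Variable V : lmodType (smash A C).

Local Notation dualres N := (rscalars (smash_dual A C) N).

Definition rational_set : set V := fun v => is_rational (v : dualres V).

Lemma rational_set0 : rational_set 0.
Proof. by apply/asboolP; exact: (rat_submod_closed (dualres V)).1.1. Qed.

Lemma rational_setD v w :
  rational_set v -> rational_set w -> rational_set (v + w).
Proof.
move=> vR wR; apply/asboolP.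
by apply: (rat_submod_closed (dualres V)).1.2; apply/asboolP.
Qed.

Lemma rational_set_dual (x : dual C) v :
  rational_set v -> rational_set (smash_dual A C x *: v).
Proof.
move=> vR; apply/asboolP.
by apply: ((rat_submod_closed (dualres V)).2 x v); apply/asboolP.
Qed.

Lemma smash_alg_scalC a k (v : V) :
  smash_alg A C a *: (smash_dual A C (dual_scal C k) *: v) =
  smash_dual A C (dual_scal C k) *: (smash_alg A C a *: v).
Proof. by rewrite -smash_kscal !scalerA -!rmorphM /= kscalC. Qed.

(** Moving y past a gives y(av) = \sum a_0 ((y a_1)v), and (y a_1)(c) = y(a_1 c) yields the pairs
    (a_1 c_i, a_0 m_i). *)
Lemma rational_set_alg a v :
  rational_set v -> rational_set (smash_alg A C a *: v).
Proof.
case=> s sE; exists (flatten [seq [seq (hact r.2 p.1, smash_alg A C r.1 *: (p.2 : V))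
                                  | p <- s] | r <- sw (ca_coact A a)]) => y.
rewrite big_flatten big_map.
rewrite -[LHS]/(smash_dual A C y *: (smash_alg A C a *: v)).
rewrite scalerA smash_dual_alg scaler_suml; apply: eq_bigr => r _.
rewrite big_map -scalerA -[smash_dual A C _ *: v]/(dact y r.2 *: (v : dualres V)).
rewrite sE scaler_sumr; apply: eq_bigr => p _ /=.
exact: smash_alg_scalC.
Qed.

Lemma rational_submodule : submodule rational_set.
Proof.
split; [exact: rational_set0 | exact: rational_setD |].
move=> s v vR; elim/smash_ind: s => [a x||s t IHs IHt].
- by rewrite smeltE -scalerA; apply/rational_set_alg/rational_set_dual.
- by rewrite scale0r; apply: rational_set0.
- by rewrite scalerDl; apply: rational_setD.
Qed.

Definition rational_part : lmodType (smash A C) := submod rational_submodule.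

Lemma rational_part_rational :
  locally_projective C -> rational_module rational_part.
Proof.
move=> lpC v; apply: (rational_res_sub lpC (@submod_val_inj _ _ _ rational_submodule)).
exact: (submodP (v : submod rational_submodule)).
Qed.

(** T maps all of [V] into the rational part ([rational_scale]), [A] preserves that part, and the
    ideal consists of sums of products of the two. *)
Lemma rational_set_ideal (y : rat_ideal A C) v :
  rational_set ((val y : smash A C) *: v).
Proof.
have [s ->] := ideal_sum y; rewrite linear_sum scaler_suml.
elim/big_ind: _ => [||p _]; [exact: rational_set0 | exact: rational_setD |].
have : rational_set (smash_alg A C p.1 *: (smash_dual A C (val p.2) *: v)).
  apply: rational_set_alg; apply: (@rational_scale K C (dualres V)).
  exact: ratP.
by rewrite scalerA.
Qed.

End RationalSubmodule.

(** * The modules of homomorphisms on the rational ideal *)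

Section RationalHom.
Variables (K : comPzRingType) (H : hopf_algebra K).
Variables (A : comodule_algebra H) (C : module_coalgebra H).
Hypotheses (lpC : locally_projective C) (flatA : flat (kmod A)).
Hypothesis ratC : rat_exact C.

Local Notation T := (rat (dual C)^o).
Local Notation dualres N := (rscalars (smash_dual A C) N).

Section Action.
Variable N : lmodType (smash A C).

Definition rat_app (g : rat_hom N flatA) (x : T) : N :=
  (g : {linear T -> dualres N}) x.

Lemma rat_hom_ext (g h : rat_hom N flatA) : rat_app g =1 rat_app h -> g = h.
Proof. exact: (@linear_ext _ T (dualres N) g h). Qed.

Lemma rat_appD g h x : rat_app (g + h) x = rat_app g x + rat_app h x.
Proof. by []. Qed.
Lemma rat_appZr g (y : dual C) x :
  rat_app g (y *: x) = smash_dual A C y *: rat_app g x.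
Proof. exact: (linearZZ (g : {linear T -> dualres N})). Qed.

Definition rat_ext (g : rat_hom N flatA) : {linear rat_ideal A C -> N} :=
  ext_hom g flatA.

Lemma rat_app_scale s g x :
  rat_app (s *: g) x = rat_ext g (ideal_mulr s (ideal_elt A x)).
Proof. by []. Qed.

Lemma rat_ext_elt g x : rat_ext g (ideal_elt A x) = rat_app g x.
Proof.
exact: (congr1 (fun h : rat_hom N flatA => rat_app h x) (ext_homK g flatA)).
Qed.

(** The extension of [g] to the ideal is linear, and the ideal is spanned over [A] by T. *)
Lemma rat_ext_mul g n :
  (forall x, rat_app g x = smash_dual A C (val x) *: n) ->
  forall y, rat_ext g y = (val y : smash A C) *: n.
Proof.
move=> gn y; have [s ->] := ideal_sum y.
rewrite !linear_sum scaler_suml; apply: eq_bigr => p _.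
rewrite linearZZ rat_ext_elt gn scalerA.
by [].
Qed.

Lemma rat_app_scale_mul g n s x :
  (forall x, rat_app g x = smash_dual A C (val x) *: n) ->
  rat_app (s *: g) x = smash_dual A C (val x) *: (s *: n).
Proof. by move=> gn; rewrite rat_app_scale (rat_ext_mul gn) scalerA. Qed.

(** The product x t stays in T, where C^*-linearity of [g] applies. So elements of T turn any [g]
    into multiplication by an element of [N]. *)
Lemma rat_app_scale_rat g (t x : T) :
  rat_app (smash_dual A C (val t) *: g) x =
  smash_dual A C (val x) *: rat_app g t.
Proof.
rewrite -rat_appZr -[RHS]rat_ext_elt rat_app_scale; congr (rat_ext g _).
by apply: val_inj; rewrite /= smashMr.
Qed.

(** By [rational_unit] some element of T fixes [n]. *)
Lemma rational_faithful (n : N) : rational_set n ->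
  (forall x : T, smash_dual A C (val x) *: n = 0) -> n = 0.
Proof.
move=> nR n0; have [t tR <-] := rational_unit lpC ratC nR.
have tP : rat_pred (t : (dual C)^o) by apply/asboolP.
exact: (n0 (Sub t tP)).
Qed.

End Action.

Section Injectivity.
Variable E : dk_module A C.
Hypothesis injE : dk_injective E.

Section Extension.
Variables (U V : lmodType (smash A C)) (i : {linear U -> V}).
Variable f : {linear U -> rat_hom (dk_smash E) flatA}.
Hypothesis i_inj : injective i.

Definition extension_graph (v : rational_part V) (e : dk_smash E) : Prop :=
  exists u, val (v : submod (@rational_submodule _ _ _ _ V)) = i u /\
    forall x, rat_app (f u) x = smash_dual A C (val x) *: e.

(** Stability under A # C^* is [rat_app_scale_mul]. At v = 0, injectivity of [i] gives u = 0, so T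
    kills [e], and [e], rational like every element of [E], vanishes. *)
Lemma extension_graph_linear : linear_graph extension_graph.
Proof.
split.
- exists 0; rewrite !linear0; split=> // x.
  by rewrite scaler0.
- move=> v w e d [u [uE ue]] [u' [uE' ue']]; exists (u + u').
  rewrite !linearD -uE -uE'; split=> // x.
  by rewrite rat_appD ue ue' scalerDr.
- move=> s v e [u [uE ue]]; exists (s *: u).
  rewrite [i _]linearZZ [f _]linearZZ -uE; split=> // x.
  exact: rat_app_scale_mul.
- move=> e [u [/esym uE ue]].
  have u0 : u = 0 by apply: i_inj; rewrite uE linear0.
  apply: rational_faithful => [|x]; first exact: dk_rational.
  by rewrite -ue u0 linear0.
Qed.

Variable g0 : {linear rational_part V -> dk_smash E}.
Hypothesis g0E : forall v e, extension_graph v e -> g0 v = e.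

Let ideal_part (v : V) (y : rat_ideal A C) : rational_part V :=
  submod_elt (@rational_submodule _ _ _ _ V) (rational_set_ideal y v).

Let lift_fun (v : V) (y : rat_ideal A C) : dk_smash E := g0 (ideal_part v y).

Let lift_linear v : linear (lift_fun v).
Proof.
move=> s y y'; rewrite /lift_fun -linearP; congr (g0 _).
by apply: val_inj; rewrite /= scalerDl -scalerA.
Qed.

Let lift (v : V) : rat_hom (dk_smash E) flatA :=
  hom_res (linear_of (lift_linear v) : hom_ideal (dk_smash E)).

(** The action on homomorphisms is right multiplication on the ideal, and y(sv) = (ys)v. *)
Let lift_is_linear : linear lift.
Proof.
move=> s v w; rewrite /lift rat_hom_scaleE -[RHS]hom_resD; congr hom_res.
apply: linear_ext => y; rewrite /= /lift_fun.
rewrite -[RHS]/(g0 (ideal_part v (ideal_mulr s y)) + g0 (ideal_part w y)).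
rewrite -linearD; congr (g0 _); apply: val_inj.
by rewrite /= scalerDr scalerA.
Qed.

(** For x in T, f(xu) = x f(u) is multiplication by f(u)(x); so the graph relates i(xu) to f(u)(x),
    the value that [g0] must take. *)
Let lift_extends u : lift (i u) = f u.
Proof.
apply: rat_hom_ext => x; apply: g0E; exists (smash_dual A C (val x) *: u).
split=> [|y]; first by rewrite [RHS]linearZZ.
by rewrite [f _]linearZZ rat_app_scale_rat.
Qed.

Lemma rat_hom_extension :
  exists g : {linear V -> rat_hom (dk_smash E) flatA}, forall u, g (i u) = f u.
Proof. by exists (linear_of lift_is_linear). Qed.

End Extension.

Lemma rat_hom_injective : injective_module (rat_hom (dk_smash E) flatA).
Proof.
move=> U V i f i_inj; have ratV := @rational_part_rational _ _ _ _ V lpC.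
have [g0 g0E] := dk_injective_graph lpC injE ratV (extension_graph_linear f i_inj).
exact: rat_hom_extension g0E.
Qed.

End Injectivity.
End RationalHom.

(** * Injective envelopes *)

Section Envelopes.
Variables (R : pzRingType) (M E : lmodType R) (i : M -> E).

Lemma module_iso_injective :
  module_iso i -> injective_module E -> injective_module M.
Proof.
move=> [iL [j ij ji]] injE U V k f k_inj.
have jL : linear j by move=> r x y; rewrite -[RHS]ij iL !ji.
have [g gE] := injE _ _ k (linear_of iL \o f) k_inj.
by exists (linear_of jL \o g) => u; rewrite /= gE /= ij.
Qed.

(** The kernel of a retraction of [i] meets the image of [i] trivially, hence is zero by
    essentiality. *)
Lemma essential_mono_bij :
  essential_mono i -> injective_module M -> bijective i.
Proof.
move=> [iL i_inj ess] injM.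
have [g gE] := injM _ _ (linear_of iL) idfun i_inj.
have kerg x : g x = 0 -> x = 0.
  apply: (ess (fun x => g x = 0)) => [|m]; last by rewrite gE.
  split=> [|x' y xk yk|r x' xk]; first exact: linear0.
    by rewrite linearD xk yk addr0.
  by rewrite linearZZ xk scaler0.
exists g => [m|e]; first exact: gE.
by apply/subr0_eq/kerg; rewrite linearB gE subrr.
Qed.

End Envelopes.

(** * The map [zeta]: essentiality, and bijectivity under finite support *)

Section Zeta.
Variables (K : comPzRingType) (H : hopf_algebra K).
Variables (A : comodule_algebra H) (C : module_coalgebra H).
Hypotheses (lpC : locally_projective C) (flatA : flat (kmod A)).
Hypothesis ratC : rat_exact C.

Local Notation T := (rat (dual C)^o).

(* Injectivity of E provides an endomorphism of E that is the identity on M and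
   vanishes on Y; essentiality makes it a monomorphism. *)
Lemma dk_essential_submodule (M E : dk_module A C) (i : dk_hom M E) :
  dk_injective_hull i -> forall Y : set (dk_smash E), submodule Y ->
  (forall m, Y (i m) -> m = 0) -> forall y, Y y -> y = 0.
Proof.
move=> [injE /(dk_mono_injective lpC) i_inj ess] Y [Y0 YD YZ] Yi.
pose j := dk_smash_map i.
(* The graph of the projection of i(M) + Y onto i(M) along [Y]. *)
pose G (v e : dk_smash E) := exists2 m, Y (v - j m) & e = j m.
have gG : linear_graph G.
  split=> [|v w _ _ [m Ym ->] [n Yn ->]|s v _ [m Ym ->]|_ [m Ym ->]].
  - by exists 0; rewrite linear0 ?subr0.
  - by exists (m + n); rewrite linearD // opprD addrACA; apply: YD.
  - by exists (s *: m); rewrite linearZZ // -scalerBr; apply: YZ.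
  - suff -> : m = 0 by rewrite linear0.
    apply: Yi; rewrite -[i m]/(j m) -[j m]opprK -scaleN1r -[- j m]add0r.
    exact: YZ.
have [g gE] := dk_injective_graph lpC injE (@dk_rational _ _ _ _ E) gG.
have [h hE] := dk_hom_of lpC g.
have hi m : h (i m) = i m.
  by rewrite hE; apply: gE; exists m; rewrite // subrr.
have h_inj : injective h.
  apply: (dk_mono_injective lpC); apply: ess; apply: injective_dk_mono.
  by move=> m n; rewrite /= !hi; apply: i_inj.
move=> y Yy; apply: h_inj; rewrite [RHS]linear0 hE; apply: gE.
by exists 0; rewrite linear0 ?subr0.
Qed.

Section Hull.
Variables (M E : dk_module A C) (i : dk_hom M E).

Lemma rat_app_zeta (m : dk_smash M) x :
  rat_app (zeta flatA i m) x = smash_dual A C (val x) *: (i m : dk_smash E).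
Proof. by []. Qed.

Lemma zeta_is_linear : linear (zeta flatA i).
Proof.
move=> s m n; apply: rat_hom_ext => x.
rewrite rat_appD (rat_app_scale_mul _ _ (rat_app_zeta m)) !rat_app_zeta.
by rewrite -scalerDr; congr (_ *: _); apply: (linearP (dk_smash_map i)).
Qed.

Lemma zeta_injective : dk_mono i -> injective (zeta flatA i).
Proof.
move=> /(dk_mono_injective lpC) i_inj m n mn; apply: i_inj.
apply/subr0_eq; apply: (rational_faithful (N := dk_smash E) lpC ratC) => [|x].
  exact: (@dk_rational _ _ _ _ E).
have := congr1 (fun g => rat_app g x) mn; rewrite !rat_app_zeta => e.
by rewrite scalerBr [X in X - _]e subrr.
Qed.

Hypothesis hull_i : dk_injective_hull i.

(** If [X] meets the image of [zeta] trivially, let [Y] consist of the e in [E] whose multiplication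
    map lies in [X]. Then [Y] meets [M] trivially, so Y = 0. For g in [X] and t in T, t g is
    multiplication by g(t), whence g(t) = 0. *)
Lemma zeta_essential : essential_mono (zeta flatA i).
Proof.
have [injE i_mono _] := hull_i.
split; [exact: zeta_is_linear | exact: zeta_injective |].
move=> X [X0 XD XZ] Xz g Xg.
pose Y (e : dk_smash E) := exists2 g : rat_hom (dk_smash E) flatA, X g &
  forall x, rat_app g x = smash_dual A C (val x) *: e.
have sY : submodule Y.
  split.
  - by exists 0 => // x; rewrite scaler0.
  - move=> e d [h Xh he] [k Xk kd]; exists (h + k); first exact: XD.
    by move=> x; rewrite rat_appD he kd scalerDr.
  - move=> s e [h Xh he]; exists (s *: h); first exact: XZ.
    by move=> x; apply: rat_app_scale_mul.
have Yi m : Y (i m) -> m = 0.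
  case=> h Xh hm; apply: Xz; suff -> : zeta flatA i m = h by [].
  by apply: rat_hom_ext => x; rewrite hm.
apply: rat_hom_ext => t; apply: (dk_essential_submodule hull_i sY Yi).
exists (smash_dual A C (val t) *: g); first exact: XZ.
exact: rat_app_scale_rat.
Qed.

Lemma zeta_envelope : injective_envelope (zeta flatA i).
Proof.
split; first exact: zeta_essential.
by case: hull_i => injE _ _; apply: rat_hom_injective.
Qed.

End Hull.

(* Writing f x = f (x e) with a local unit e, and t for an element of T acting
   as the identity on M, gives f x = x (t (f e)) = x (f (e t)) = x (f t). *)
Lemma zeta_finite_support (M : dk_module A C) (i : dk_hom M M) (U : set (dual C)) :
  (forall m, i m = m) -> local_units U -> finite_support U M ->
  module_iso (zeta flatA i).
Proof.
move=> iE [Urat _ Ucomm Uunit] [F [_ FU Fid]].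
split; first exact: zeta_is_linear.
pose t0 := \sum_(e <- F) e.
have t0P : rat_pred (t0 : (dual C)^o).
  rewrite /t0 big_seq; elim/big_ind: _ => [|x y xR yR|e eF].
  - exact: (rat_submod_closed (dual C)^o).1.1.
  - exact: (rat_submod_closed (dual C)^o).1.2.
  - exact/asboolP/Urat/FU.
have t0C e : U e -> t0 * e = e * t0.
  move=> Ue; rewrite /t0 mulr_suml mulr_sumr big_seq [RHS]big_seq.
  by apply: eq_bigr => e' /FU Ue'; apply: Ucomm.
pose t : T := Sub t0 t0P.
(* Evaluation at [t] inverts [zeta], since [t] fixes every element of [M]. *)
exists (fun g => rat_app g t) => [m|g].
  by rewrite rat_app_zeta iE; apply: Fid.
apply: rat_hom_ext => x; rewrite rat_app_zeta iE.
have [e [Ue xe _]] := Uunit _ (ratP x).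
have eP : rat_pred (e : (dual C)^o) by apply/asboolP/Urat.
pose e' : T := Sub e eP.
have xE : x = (val x : dual C) *: e' by apply: val_inj; rewrite /= -[LHS]xe.
have te : t0 *: e' = e *: t by apply: val_inj; rewrite /=; exact: (t0C e Ue).
have ge : smash_dual A C t0 *: rat_app g e' = rat_app g e' by apply: Fid.
rewrite [in RHS]xE rat_appZr -ge.
by rewrite -rat_appZr te rat_appZr scalerA -rmorphM /= xe.
Qed.

End Zeta.

(** * The antipode *)

Section Antipode.
Variables (K : comPzRingType) (H : hopf_algebra K).
Local Notation S := (antipode H).
Implicit Types g h : H.

Lemma kmod_linear_mull h : linear (fun a : kmod H => h * (a : H) : kmod H).
Proof. by move=> k a b; rewrite mulrDr !kmod_scaleE kscalCA. Qed.

Lemma kmod_linear_mulr h : linear (fun a : kmod H => (a : H) * h : kmod H).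
Proof. by move=> k a b; rewrite mulrDl !kmod_scaleE mulrA. Qed.

Lemma mul_balanced (L R : {linear kmod H -> kmod H}) :
  balanced (fun a b : kmod H => (L a : H) * (R b : H)).
Proof.
split=> [b a a'|a b b'|k a b] /=; rewrite ?linearD ?mulrDl ?mulrDr //.
by rewrite [L (_ *: _)]linearZZ [R (_ *: _)]linearZZ !kmod_scaleE kscalCA mulrA.
Qed.

(** Coassociativity evaluated on L(h_1) h_2 R(h_3). *)
Lemma comul_mul3 (L R : {linear kmod H -> kmod H}) h :
  \sum_(p <- sw (hopf_comul H h)) \sum_(q <- sw (hopf_comul H p.1))
    (L q.1 : H) * ((q.2 : H) * R p.2) =
  \sum_(p <- sw (hopf_comul H h)) \sum_(q <- sw (hopf_comul H p.2))
    (L p.1 : H) * ((q.1 : H) * R q.2).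
Proof.
apply: (comul_trilinear (C := hopf_coalg H)
  (f := fun a b c : kmod H => (L a : H) * ((b : H) * R c))) => x.
  have := mul_balanced (linear_of (kmod_linear_mull (L x))) R.
  by congr balanced; apply/funext => b; apply/funext => c; rewrite /= mulrA.
exact: (mul_balanced L (linear_of (kmod_linear_mulr (R x)))).
Qed.

(** After reassociation, S(h_1) h_2 collapses to the counit. *)
Lemma antipode_cancel (R : {linear kmod H -> kmod H}) h :
  \sum_(p <- sw (hopf_comul H h)) \sum_(q <- sw (hopf_comul H p.2))
    (S p.1 : H) * ((q.1 : H) * R q.2) = R h.
Proof.
rewrite -comul_mul3 -[h in RHS](counitl (hopf_coalgP H) h) linear_sum.
apply: eq_bigr => p _; under eq_bigr do rewrite mulrA.
by rewrite -mulr_suml antipodel [RHS]linearZZ.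
Qed.

Lemma antipode_counit h :
  \sum_(p <- sw (hopf_comul H h)) (S p.1 : H) * kscal H (hopf_counit H p.2) = S h.
Proof.
rewrite -[h in RHS](counitr (hopf_coalgP H) h) linear_sum.
by apply: eq_bigr => p _; rewrite [RHS]linearZZ kmod_scaleE kscalC.
Qed.

(** The antipode axiom at gh, with the comultiplication of the product expanded. *)
Lemma antipode_mul_counit g h :
  \sum_(p <- sw (hopf_comul H g)) \sum_(q <- sw (hopf_comul H h))
    (p.1 : H) * ((q.1 : H) * S ((p.2 : H) * q.2)) =
  kscal H (hopf_counit H g) * kscal H (hopf_counit H h).
Proof.
rewrite -rmorphM -hopf_counitM -antipoder hopf_comulM.
rewrite (sw_sum (mul_balanced idfun S)); apply: eq_bigr => p _.
rewrite (sw_sum (mul_balanced idfun S)); apply: eq_bigr => q _.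
by rewrite (sw_tens (mul_balanced idfun S)) /= mulrA.
Qed.

(* Both sides are the value of S(h_1) S(g_1) g_2 h_2 S(g_3 h_3). *)
Lemma antipodeM g h : S (g * h) = (S h : H) * S g :> H.
Proof.
pose D := hopf_comul H.
pose X := \sum_(q <- sw (D h)) \sum_(q' <- sw (D q.2))
  \sum_(p <- sw (D g)) \sum_(p' <- sw (D p.2)) (S q.1 : H) *
   ((S p.1 : H) * ((p'.1 : H) * ((q'.1 : H) * S ((p'.2 : H) * q'.2)))).
transitivity X.
  (* The cancellation in [h] uses R(x) = S(gx); then, inside each summand, that in [g] uses R(x) =
     h_2 S(x h_3). *)
  rewrite -[LHS](antipode_cancel (S \o linear_of (kmod_linear_mull g)) h).
  apply: eq_bigr => q _; apply: eq_bigr => q' _.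
  under [RHS]eq_bigr do rewrite -mulr_sumr.
  rewrite -mulr_sumr; congr (_ * _).
  exact: (esym (antipode_cancel (linear_of (kmod_linear_mull (q'.1 : H)) \o
    (S \o linear_of (kmod_linear_mulr (q'.2 : H)))) g)).
(* On this side g_2 h_2 S(g_3 h_3) becomes a product of counits, leaving S(h) S(g). *)
rewrite -(antipode_counit h) mulr_suml; apply: eq_bigr => q _.
rewrite exchange_big -(antipode_counit g) mulr_sumr; apply: eq_bigr => p _.
rewrite -[RHS]mulrA kscalC -[_ * _ * kscal H _ in RHS]mulrA.
rewrite -antipode_mul_counit exchange_big !mulr_sumr; apply: eq_bigr => p' _.
by rewrite !mulr_sumr.
Qed.

Lemma antipode1 : S 1 = 1 :> H.
Proof.
have := antipodel (1 : H).
by rewrite hopf_comul1 hopf_counit1 rmorph1 (sw_tens (mul_balanced S idfun)) mulr1.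
Qed.

Lemma antipode_kscal k : S (kscal H k) = kscal H k :> H.
Proof.
have := linearZZ S k (1 : H).
by rewrite !kmod_scaleE mulr1 antipode1 mulr1.
Qed.

Section Inverse.
Variable T : H -> H.
Hypotheses (ST : cancel S T) (TS : cancel T S).

Fact antipode_inv_linear : linear (T : kmod H -> kmod H).
Proof. by move=> k a b; rewrite -[RHS]ST linearP !TS. Qed.

Lemma antipode_invM g h : T (g * h) = T h * T g.
Proof. by rewrite -[RHS]ST antipodeM !TS. Qed.

(** The antipode reverses products and is injective, so applying it reduces the claim to
    [antipoder]. The inverse is thus an antipode for the opposite comultiplication. *)
Lemma antipode_invr h :
  \sum_(p <- sw (hopf_comul H h)) (p.2 : H) * T p.1 = kscal H (hopf_counit H h).
Proof.
apply: (can_inj ST); rewrite antipode_kscal linear_sum -antipoder.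
by apply: eq_bigr => p _; rewrite antipodeM TS.
Qed.

Lemma antipode_invl h :
  \sum_(p <- sw (hopf_comul H h)) T p.2 * (p.1 : H) = kscal H (hopf_counit H h).
Proof.
apply: (can_inj ST); rewrite antipode_kscal linear_sum -antipodel.
by apply: eq_bigr => p _; rewrite antipodeM TS.
Qed.

End Inverse.

End Antipode.

(** * Extension of scalars to the smash product *)

Lemma tens_linear_bal (K : comPzRingType) (M N N' : lmodType K)
  (g : {linear N -> N'}) : balanced (fun (m : M) (n : N) => m \ten g n).
Proof.
split=> [n m m'|m n n'|k m n]; first exact: tensDl.
  by rewrite linearD tensDr.
by rewrite linearZZ tensZr tensZl.
Qed.

Fact kres_linear (K : comPzRingType) (A : kalgebra K) (U V : lmodType A)
  (i : {linear U -> V}) : linear (i : kres U -> kres V).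
Proof. by move=> k u u'; apply: (linearP i (kscal A k)). Qed.

Definition kres_map (K : comPzRingType) (A : kalgebra K) (U V : lmodType A)
  (i : {linear U -> V}) : {linear kres U -> kres V} := linear_of (kres_linear i).

Section ScalarExtension.
Variables (K : comPzRingType) (H : hopf_algebra K).
Variables (A : comodule_algebra H) (C : module_coalgebra H).

Local Notation ksmash := (kmod A \tens dual C).

Lemma smash_scalerAr k (s t : smash A C) :
  s * (k *: (t : ksmash) : ksmash) = k *: (s * t : ksmash) :> ksmash.
Proof.
elim/smash_ind: t => [b y||t t' IHt IHt'].
- elim/smash_ind: s => [a x||s s' IHs IHs'].
  + rewrite -[k *: _](tensZr k) [LHS]smashM [in RHS]smashM scaler_sumr.
    apply: eq_bigr => r _.
    by rewrite -dual_scalerAr; apply: tensZr.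
  + by rewrite !mul0r scaler0.
  + by rewrite !mulrDl scalerDr IHs IHs'.
- by rewrite scaler0 !mulr0 scaler0.
- by rewrite scalerDr !mulrDr scalerDr IHt IHt'.
Qed.

Section Tensor.
Variable V : lmodType K.

(** The tensor product is over [K]; the relations sa (x) v = s (x) av, which give the tensor product
    over [A], are imposed later by [TensorGraphAlg]. *)
Definition smash_tensor : Type := ksmash \tens V.
HB.instance Definition _ := GRing.Zmodule.copy smash_tensor (ksmash \tens V).

Definition stens (s : smash A C) (v : V) : smash_tensor := s \ten[ksmash, V] v.

Definition smash_tensor_scale (s : smash A C) (t : smash_tensor) : smash_tensor :=
  \sum_(p <- sw t) stens (s * (p.1 : smash A C)) p.2.

Fact smash_tensor_bal s :
  balanced (fun (u : ksmash) (v : V) => stens (s * (u : smash A C)) v).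
Proof.
split=> [v u u'|u v v'|k u v].
- by rewrite mulrDr; apply: tensDl.
- exact: tensDr.
- by rewrite smash_scalerAr; apply: (balancedZ (@tens_balanced _ ksmash V)).
Qed.

Lemma smash_tensor_scale_tens s u v :
  smash_tensor_scale s (stens u v) = stens (s * u) v.
Proof. exact: (sw_tens (smash_tensor_bal s)). Qed.

Fact smash_tensor_scaleDr : right_distributive smash_tensor_scale +%R.
Proof. by move=> s t u; apply: (swD (smash_tensor_bal s)). Qed.

Fact smash_tensor_scale0 s : smash_tensor_scale s 0 = 0.
Proof. exact: (sw0 (smash_tensor_bal s)). Qed.

Lemma smash_tensor_ind (P : smash_tensor -> Prop) :
  (forall s v, P (stens s v)) -> P 0 ->
  (forall t u, P t -> P u -> P (t + u)) -> forall t, P t.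
Proof. exact: (@tens_ind K ksmash V). Qed.

Fact smash_tensor_scaleA r s t :
  smash_tensor_scale r (smash_tensor_scale s t) = smash_tensor_scale (r * s) t.
Proof.
elim/smash_tensor_ind: t => [u v||t t' IHt IHt'].
- by rewrite !smash_tensor_scale_tens mulrA.
- by rewrite !smash_tensor_scale0.
- by rewrite !smash_tensor_scaleDr IHt IHt'.
Qed.

Fact smash_tensor_scale1 : left_id 1 smash_tensor_scale.
Proof.
move=> t; elim/smash_tensor_ind: t => [u v||t t' IHt IHt'].
- by rewrite smash_tensor_scale_tens mul1r.
- by rewrite smash_tensor_scale0.
- by rewrite smash_tensor_scaleDr IHt IHt'.
Qed.

Fact smash_tensor_scaleDl t : {morph smash_tensor_scale^~ t : r s / r + s}.
Proof.
move=> r s; rewrite /smash_tensor_scale -big_split; apply: eq_bigr => p _.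
by rewrite mulrDl; apply: tensDl.
Qed.

HB.instance Definition _ := GRing.Zmodule_isLmodule.Build (smash A C) smash_tensor
  smash_tensor_scaleA smash_tensor_scale1 smash_tensor_scaleDr
  smash_tensor_scaleDl.

Lemma stensZ r s v : r *: stens s v = stens (r * s) v.
Proof. exact: smash_tensor_scale_tens. Qed.

Lemma stensDr s v w : stens s (v + w) = stens s v + stens s w.
Proof. exact: tensDr. Qed.

End Tensor.

(** * Untwisting the scalar extension by the inverse antipode *)

Section Untwisting.
Variable T : H -> H.
Hypotheses (ST : cancel (antipode H) T) (TS : cancel T (antipode H)).

Lemma antipode_invZ k (h : H) : T (kscal H k * h) = kscal H k * T h.
Proof. exact: (linearZZ (linear_of (antipode_inv_linear ST TS)) k h). Qed.

Lemma antipode_invD (g h : H) : T (g + h) = T g + T h.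
Proof. exact: (linearD (linear_of (antipode_inv_linear ST TS)) g h). Qed.

Lemma kscalerC (V : lmodType A) k (a : A) (v : kres V) :
  (a : A) *: (k *: v : kres V) = k *: ((a : A) *: (v : V) : kres V) :> kres V.
Proof. by rewrite -[k *: v]/(kscal A k *: (v : V)) scalerA -kscalC -scalerA. Qed.

Section Map.
Variable V : lmodType A.

Local Notation W := (dual C \tens kres V).

Definition act_tens (y : dual C) (h : H) (a : A) (v : V) : W :=
  dact y h \ten[dual C, kres V] (a *: v).

Fact act_tens_bal y v : balanced (fun (a : kmod A) (h : hopf_coalg H) =>
  act_tens y (T h) a v).
Proof.
split=> [h a a'|a h h'|k a h]; rewrite /act_tens.
- by rewrite scalerDl tensDr.
- by rewrite antipode_invD dactDr tensDl.
- rewrite kmod_scaleE hopf_scaleE antipode_invZ dactZr tensZl -scalerA.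
  exact: (@tensZr K (dual C) (kres V) k (dact y (T h)) ((a : A) *: v : V)).
Qed.

(* The isomorphism of (A # C^* ) (x)_A V with C^* (x) V, precomposed with the
   projection of (A # C^* ) (x)_K V; T is the inverse antipode. *)
Definition untwist_elt (s : smash A C) (v : V) : W :=
  \sum_(p <- sw s) \sum_(r <- sw (ca_coact A p.1)) act_tens p.2 (T r.2) r.1 v.

Fact untwist_elt_bal1 v : balanced (fun (a : kmod A) (x : dual C) =>
  \sum_(r <- sw (ca_coact A a)) act_tens x (T r.2) r.1 v).
Proof.
split=> [x a a'|a x x'|k a x].
- by rewrite linearD (swD (act_tens_bal x v)).
- rewrite -big_split; apply: eq_bigr => r _.
  by rewrite /act_tens dactDl tensDl.
- rewrite linearZ (swZ (act_tens_bal x v)); apply: eq_bigr => r _.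
  rewrite /act_tens dactZl tensZl kmod_scaleE -scalerA.
  exact: (@tensZr K (dual C) (kres V) k (dact x (T r.2)) ((r.1 : A) *: v : V)).
Qed.

Lemma untwist_smelt a x v : untwist_elt (smelt a x) v =
  \sum_(r <- sw (ca_coact A a)) act_tens x (T r.2) r.1 v.
Proof. exact: (sw_tens (untwist_elt_bal1 v)). Qed.

Fact untwist_elt_bal :
  balanced (fun (s : ksmash) (v : kres V) => untwist_elt s v).
Proof.
split=> [v s t|s v w|k s v].
- exact: (swD (untwist_elt_bal1 v)).
- rewrite /untwist_elt -big_split; apply: eq_bigr => p _.
  rewrite -big_split; apply: eq_bigr => r _.
  rewrite -[RHS](@tensDr K (dual C) (kres V)) /act_tens; congr (_ \ten _).
  exact: (scalerDr (r.1 : A) (v : V) w).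
- rewrite /untwist_elt (swZ (untwist_elt_bal1 v)); apply: eq_bigr => p _.
  rewrite linearZ (swZ (act_tens_bal p.2 v)); apply: eq_bigr => r _.
  rewrite /act_tens; congr (_ \ten _).
  by rewrite kscalerC kmod_scaleE -scalerA.
Qed.

Definition untwist (t : smash_tensor (kres V)) : W :=
  \sum_(p <- sw t) untwist_elt p.1 p.2.

Lemma untwistD t u : untwist (t + u) = untwist t + untwist u.
Proof. exact: (swD untwist_elt_bal). Qed.
Lemma untwist0 : untwist 0 = 0.
Proof. exact: (sw0 untwist_elt_bal). Qed.
Lemma untwist_tens s v : untwist (stens s (v : kres V)) = untwist_elt s v.
Proof. exact: (sw_tens untwist_elt_bal). Qed.

(** Well-definedness over [A]: for s = b # y the functional becomes y a_2 T(a_1) T(b_1), and a_2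
    T(a_1) collapses to the counit. *)
Lemma untwist_elt_alg s (a : A) v :
  untwist_elt (s * smash_alg A C a) v = untwist_elt s (a *: v).
Proof.
elim/smash_ind: s => [b y||s t IHs IHt]; first last.
- by rewrite mulrDl !(balancedDl untwist_elt_bal) IHs IHt.
- by rewrite mul0r /untwist_elt !(sw0 (untwist_elt_bal1 _)).
rewrite smashM untwist_smelt.
(* The arguments stand for the pair (b_0, b_1) and for a_0, a_1, a_2. *)
pose F (p : A * H) (c : kmod A) (g h : hopf_coalg H) : W :=
  act_tens y ((h : H) * (T g * T p.2)) p.1 ((c : A) *: v).
transitivity (\sum_(r <- sw (ca_coact A a)) \sum_(p <- sw (ca_coact A b))
    \sum_(q <- sw (ca_coact A r.1)) F p q.1 q.2 r.2).
  rewrite {1}/untwist_elt (sw_sum (untwist_elt_bal1 v)); apply: eq_bigr => r _.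
  rewrite (sw_tens (untwist_elt_bal1 v)) ca_coactM.
  rewrite (sw_sum (act_tens_bal _ v)); apply: eq_bigr => p _.
  rewrite (sw_sum (act_tens_bal _ v)); apply: eq_bigr => q _.
  rewrite (sw_tens (act_tens_bal _ v)) mulr1 /F /act_tens.
  by rewrite dactA (antipode_invM ST TS) scalerA.
rewrite exchange_big; apply: eq_bigr => p _.
rewrite (coaction_trilinear (f := F p) _ (ca_comodule A)).
- rewrite -[in RHS](coact_counit (ca_comodule A) a) scaler_suml.
  rewrite /act_tens scaler_sumr tens_sumr; apply: eq_bigr => r _.
  rewrite /F /act_tens -tens_suml -dact_sumr.
  under eq_bigr do rewrite mulrA.
  rewrite -mulr_suml (antipode_invr ST TS) dactZr tensZl kmod_scaleE.
  rewrite -scalerA -[kscal A _ *: _]/(_ *: ((r.1 : A) *: v : kres V)).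
  by rewrite kscalerC tensZr.
- move=> c; split=> [h g g'|g h h'|k g h]; rewrite /F /act_tens.
  + by rewrite antipode_invD mulrDl mulrDr dactDr tensDl.
  + by rewrite mulrDl dactDr tensDl.
  + by rewrite !hopf_scaleE antipode_invZ -mulrA kscalCA mulrA.
- move=> h; split=> [g c c'|c g g'|k c g]; rewrite /F /act_tens.
  + by rewrite scalerDl scalerDr tensDr.
  + by rewrite antipode_invD mulrDl mulrDr dactDr tensDl.
  + rewrite hopf_scaleE antipode_invZ -mulrA kscalCA dactZr tensZl.
    rewrite kmod_scaleE -scalerA -[kscal A _ *: _]/(_ *: ((c : A) *: v : kres V)).
    by rewrite kscalerC tensZr.
Qed.

End Map.

Lemma untwist_elt_tmap (U V : lmodType A) (i : {linear U -> V}) s u :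
  untwist_elt s (i u) = tmap (M := dual C) id (kres_map i) (untwist_elt s u).
Proof.
have iB := tens_linear_bal (dual C) (kres_map i).
rewrite /tmap (sw_sum iB); apply: eq_bigr => p _.
rewrite (sw_sum iB); apply: eq_bigr => r _.
rewrite (sw_tens iB) /act_tens; congr (_ \ten _).
exact/esym/(linearZZ i).
Qed.

Section Evaluation.
Variables (N : lmodType (smash A C)) (U : lmodType A).
Variable f : {linear U -> rscalars (smash_alg A C) N}.

Definition dual_eval (w : dual C \tens kres U) : N :=
  \sum_(p <- sw w) smash_dual A C p.1 *: (f p.2 : N).

Fact dual_eval_bal : balanced (fun (x : dual C) (u : kres U) =>
  smash_dual A C x *: (f u : N)).
Proof.
split=> [u x y|x u w|k x u].
- by rewrite rmorphD scalerDl.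
- by rewrite [f _]linearD; apply: scalerDr.
- rewrite -[k *: u]/(kscal A k *: (u : U)) [f (_ *: _)]linearZZ.
  rewrite -[_ *: f u]/(smash_alg A C (kscal A k) *: (f u : N)).
  by rewrite scalerA smash_kscal -rmorphM /= dual_scalEr.
Qed.

(** Moving y T(b_1) past b_0 gives b_0 # y T(b_2) b_1, and T(b_2) b_1 collapses to the counit. Thus
    s (x) u -> s f(u) factors through C^* (x) U. *)
Lemma dual_eval_untwist s u : dual_eval (untwist_elt s u) = s *: (f u : N).
Proof.
elim/smash_ind: s => [b y||s t IHs IHt]; first last.
- rewrite (balancedDl (untwist_elt_bal U)) /dual_eval (swD dual_eval_bal).
  by rewrite -!/(dual_eval _) IHs IHt scalerDl.
- rewrite /untwist_elt (sw0 (untwist_elt_bal1 u)) /dual_eval (sw0 dual_eval_bal).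
  by rewrite scale0r.
rewrite untwist_smelt /dual_eval (sw_sum dual_eval_bal).
pose F (c : kmod A) (g h : hopf_coalg H) : smash A C :=
  smelt c (dact y (T h * (g : H))).
transitivity ((\sum_(r <- sw (ca_coact A b))
    \sum_(q <- sw (ca_coact A r.1)) F q.1 q.2 r.2) *: (f u : N)).
  rewrite scaler_suml; apply: eq_bigr => r _.
  rewrite (sw_tens dual_eval_bal) [f _]linearZZ.
  rewrite -[(r.1 : A) *: f u]/(smash_alg A C r.1 *: (f u : N)) scalerA.
  rewrite smash_dual_alg; congr (_ *: _); apply: eq_bigr => q _.
  by rewrite -smeltE dactA.
congr (_ *: _); rewrite (coaction_trilinear (f := F) _ (ca_comodule A)).
- rewrite -[b in RHS](coact_counit (ca_comodule A) b) smelt_suml.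
  apply: eq_bigr => r _; rewrite /F -smelt_sumr -dact_sumr (antipode_invl ST TS).
  by rewrite -[kscal H _]mulr1 dactZr dact1 kmod_scaleE smeltZ.
- move=> c; split=> [h g g'|g h h'|k g h]; rewrite /F.
  + by rewrite mulrDr dactDr smeltDr.
  + by rewrite antipode_invD mulrDl dactDr smeltDr.
  + by rewrite !hopf_scaleE antipode_invZ kscalCA mulrA.
- move=> h; split=> [g c c'|c g g'|k c g]; rewrite /F.
  + exact: smeltDl.
  + by rewrite mulrDr dactDr smeltDr.
  + by rewrite kmod_scaleE hopf_scaleE kscalCA dactZr smeltZ.
Qed.

Section Extension.
Variables (V : lmodType A) (i : {linear U -> V}).

(* The graph of the map induced by f on the image of (A # C^* ) (x)_A U in
   (A # C^* ) (x)_A V, pulled back to (A # C^* ) (x)_K V. *)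
Inductive tensor_graph : smash_tensor (kres V) -> N -> Prop :=
| TensorGraph0 : tensor_graph 0 0
| TensorGraphAlg s a (v : V) : tensor_graph
    (stens (s * smash_alg A C a) (v : kres V) - stens (V := kres V) s (a *: v : V)) 0
| TensorGraphImage s u : tensor_graph (stens s (i u : kres V)) (s *: (f u : N))
| TensorGraphD t t' n n' : tensor_graph t n -> tensor_graph t' n' ->
    tensor_graph (t + t') (n + n').

(** By induction: the relations over [A] untwist to 0, and s (x) i(u) untwists to the image of the
    untwisting of s (x) u. This controls the values of the graph by elements of C^* (x) U. *)
Lemma tensor_graph_eval t n : tensor_graph t n -> exists2 w,
  untwist t = tmap (M := dual C) id (kres_map i) w &
  n = dual_eval w.
Proof.
have iB := tens_linear_bal (dual C) (kres_map i).
elim=> {t n} [|s a v|s u|t t' n n' _ [w tw nw] _ [w' tw' nw']].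
- exists 0; rewrite /tmap /dual_eval ?(sw0 iB) ?(sw0 dual_eval_bal) //.
  exact: untwist0.
- exists 0; rewrite /tmap /dual_eval ?(sw0 iB) ?(sw0 dual_eval_bal) //.
  apply: (addIr (untwist (stens (V := kres V) s (a *: v : V)))).
  by rewrite -untwistD subrK add0r !untwist_tens untwist_elt_alg.
- exists (untwist_elt s u); last by rewrite dual_eval_untwist.
  by rewrite untwist_tens; apply: untwist_elt_tmap.
- exists (w + w'); rewrite /tmap /dual_eval ?(swD iB) ?(swD dual_eval_bal).
    by rewrite untwistD tw tw'.
  by rewrite nw nw'.
Qed.

Hypotheses (flatC : flat (dual C)) (i_inj : injective i).

Lemma tensor_graph_linear : linear_graph tensor_graph.
Proof.
split; [exact: TensorGraph0 | by move=> *; apply: TensorGraphD | |].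
- move=> r t n; elim=> {t n} [|s a v|s u|t t' n n' _ IHt _ IHt'].
  + by rewrite !scaler0; apply: TensorGraph0.
  + rewrite scaler0 scalerBr !stensZ mulrA; apply: TensorGraphAlg.
  + by rewrite stensZ scalerA; apply: TensorGraphImage.
  + by rewrite !scalerDr; apply: TensorGraphD.
(* Over t = 0 the element [w] dies under id (x) i, so it is 0 by flatness, and n is its
   evaluation. *)
- move=> n /tensor_graph_eval[w]; rewrite untwist0 => w0 ->.
  suff -> : w = 0 by rewrite /dual_eval (sw0 dual_eval_bal).
  apply: (flatC (f := kres_map i) i_inj); rewrite -w0 /tmap.
  by rewrite (sw0 (tens_linear_bal (dual C) (kres_map i))).
Qed.

(** The extension is v -> g(1 (x) v); it is [A]-linear because the graph gives a (x) v - 1 (x) av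
    the value 0. *)
Lemma injective_algres_extension : injective_module N ->
  exists g : {linear V -> rscalars (smash_alg A C) N}, forall u, g (i u) = f u.
Proof.
move=> injN; have [g gE] := injective_graph tensor_graph_linear injN.
have gL : linear (fun v : V =>
    g (stens 1 (v : kres V)) : rscalars (smash_alg A C) N).
  move=> a v w.
  rewrite -[RHS]/(smash_alg A C a *: g (stens 1 (v : kres V)) +
    g (stens 1 (w : kres V))).
  rewrite [stens 1 _](stensDr (V := kres V) 1 (a *: v : V) w) linearD.
  congr (_ + _); rewrite -linearZ stensZ mulr1.
  apply/esym/subr0_eq; rewrite -linearB; apply: gE.
  by rewrite -[smash_alg A C a]mul1r; apply: TensorGraphAlg.
exists (linear_of gL) => u; rewrite /= -[RHS]scale1r.
exact/gE/TensorGraphImage.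
Qed.

End Extension.
End Evaluation.
End Untwisting.
End ScalarExtension.

(** Conceptually, restriction of scalars to [A] has an exact left adjoint. *)
Lemma injective_restriction (K : comPzRingType) (H : hopf_algebra K)
    (A : comodule_algebra H) (C : module_coalgebra H) (N : lmodType (smash A C)) :
  bijective (antipode H) -> flat (dual C) ->
  injective_module N -> injective_module (rscalars (smash_alg A C) N).
Proof.
move=> [T ST TS] flatC injN U V i f i_inj.
exact: (injective_algres_extension ST TS f flatC i_inj injN).
Qed.

Theorem corollary2p4 (K : comPzRingType) (H : hopf_algebra K)
    (A : comodule_algebra H) (C : module_coalgebra H)
    (lpC : locally_projective C) (flatA : flat (kmod A)) (ratC : rat_exact C)
    (M : dk_module A C) :
  (forall (E : dk_module A C) (i : dk_hom M E), dk_injective_hull i ->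
     injective_envelope (zeta flatA i) /\
     (injective_module (dk_smash M) <->
        dk_injective M /\ module_iso (zeta flatA i))) /\
  (bijective (antipode H) -> flat (dual C) -> dk_injective M ->
     forall U : set (dual C), local_units U -> finite_support U M ->
       injective_module (dk_mod M)).
Proof.
split=> [E i hull_i|antiH flatC injM U unitU suppM].
  have [ess injQ] := zeta_envelope lpC flatA ratC hull_i.
  split=> //; split=> [injM|[_ iso]].
    split; first exact: injective_dk_injective.
    by split; [exact: zeta_is_linear | exact: essential_mono_bij].
  exact: module_iso_injective iso injQ.
(* The identity as a morphism, so that [M] takes the place of its hull in [zeta]. *)
have [i iE] := dk_hom_of lpC (idfun : {linear dk_smash M -> dk_smash M}).
have iso := zeta_finite_support flatA iE unitU suppM.
have injQ := rat_hom_injective lpC (flatA := flatA) ratC injM.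
have injS := module_iso_injective iso injQ.
have injA := injective_restriction antiH flatC injS.
(* [M] and the restriction of its A # C^*-structure have the same elements and, by [dk_alg_scale],
   the same action of [A]; injectivity is transported along the identity. *)
pose j (m : dk_mod M) : rscalars (smash_alg A C) (dk_smash M) := m.
have jL : linear j by move=> a m n; congr (_ + _); apply/esym/dk_alg_scale.
have j_bij : bijective j by exists id.
exact: (module_iso_injective (conj jL j_bij) injA).
Qed.
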